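(* For every compactly supported smooth Hamiltonian function $H:[0,1]\times M\to\mathbb{R}$ on $M=\mathbb{T}^n\times\mathbb{D}^n$ and every $e\in\mathbb{Z}^n$ such that $$|e|\le c:=\inf_{[0,1]\times Z}H,$$ the Hamiltonian system $\dot q=\frac{\partial H}{\partial p}(t,q,p)$, $\dot p=-\frac{\partial H}{\partial q}(t,q,p)$ has a periodic solution $x(t)$ in the homotopy class $e$ with action $\mathcal{A}_H(x)\ge c$.
   Context: $M=U^*\mathbb{T}^n=\mathbb{T}^n\times\mathbb{D}^n$ is the open unit cotangent bundle of the Euclidean torus $\mathbb{T}^n=\mathbb{R}^n/\mathbb{Z}^n$, with canonical coordinates $(q,p)$, $\mathbb{D}^n=\{|p|<1\}\subset\mathbb{R}^n$, $|\cdot|$ the Euclidean norm, and $Z=\{p=0\}\subset M$ the zero section. A solution $x(t)=(q(t),p(t))$, $t\in[0,1]$, of the Hamiltonian system is periodic in the homotopy class $e\in\mathbb{Z}^n$ if $p(1)=p(0)$ and, for a lift of $q$ to $\mathbb{R}^n$, $q(1)=q(0)+e$. Its action is $$\mathcal{A}_H(x)=\int_0^1\Big(H(t,q(t),p(t))-\sum_{i=1}^n p_i(t)\dot q_i(t)\Big)\,dt.$$ *)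

(* Defs.v *)
From HB Require Import structures.
From mathcomp Require Import all_boot all_order all_algebra.
From mathcomp Require Import all_classical all_reals all_analysis.

Set Implicit Arguments.
Unset Strict Implicit.
Unset Printing Implicit Defensive.

Import Order.TTheory GRing.Theory Num.Theory.
Import numFieldNormedType.Exports.

Local Open Scope classical_set_scope.
Local Open Scope ring_scope.

(* The library norm on ['rV[R]_n] is the sup norm, hence this definition.     *)
Definition enorm (R : realType) (n : nat) (x : 'rV[R]_n) : R :=
  Num.sqrt (\sum_(i < n) x 0 i ^+ 2).

Definition vecZ (R : realType) (n : nat) (e : 'rV[int]_n) : 'rV[R]_n :=
  map_mx intr e.
Arguments vecZ R {n} e.

(* A point (t, q, p); q is a point of the universal cover R^n of the torus.   *)
Notation extended_phase R n := (R * 'rV[R]_n * 'rV[R]_n)%type.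

(* The cover [0,1] x R^n x D^n of [0,1] x M.                                  *)
Definition time_phase (R : realType) (n : nat) : set (extended_phase R n) :=
  [set z | 0 <= z.1.1 <= 1 /\ enorm z.2 < 1].

(* The cover of [0,1] x Z, with Z the zero section.                           *)
Definition zero_section (R : realType) (n : nat) : set (extended_phase R n) :=
  [set z | 0 <= z.1.1 <= 1 /\ z.2 = 0].

Definition translate (R : realType) (n : nat) (k : 'rV[int]_n)
    (z : extended_phase R n) : extended_phase R n :=
  (z.1.1, z.1.2 + vecZ R k, z.2).

(* [iter_derive f [:: v1; ...; vk]] is D_v1 (... (D_vk f)).                   *)
Definition iter_derive (R : realType) (V : normedModType R) (f : V -> R)
    (vs : seq V) : V -> R :=
  foldr (fun v g => 'D_v g) f vs.

Definition smooth_on_open (R : realType) (V : normedModType R) (U : set V)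
    (f : V -> R) : Prop :=
  open U /\
  forall (vs : seq V) (x : V), U x ->
    {for x, continuous (iter_derive f vs)} /\
    forall v : V, derivable (iter_derive f vs) x v.

(* Smoothness on an arbitrary subset: local extendability to a smooth         *)
(* function on an open set, needed at the boundary times 0 and 1.             *)
Definition smooth_on (R : realType) (V : normedModType R) (A : set V)
    (f : V -> R) : Prop :=
  forall x, A x -> exists (U : set V) (g : V -> R),
    [/\ U x, smooth_on_open U g & forall y, A y -> U y -> f y = g y].

(* A function on [0,1] x M is a Z^n-periodic function on [time_phase R n];    *)
(* the values of H outside this set are irrelevant.                           *)
Definition torus_periodic (R : realType) (n : nat)
    (H : extended_phase R n -> R) : Prop :=
  forall z, time_phase z -> forall k, H (translate k z) = H z.

(* The compact subsets of [0,1] x M are the images of the compact subsets K   *)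
(* of [time_phase R n].                                                       *)
Definition compactly_supported (R : realType) (n : nat)
    (H : extended_phase R n -> R) : Prop :=
  exists K : set (extended_phase R n),
    [/\ compact K, K `<=` @time_phase R n &
        forall z, time_phase z -> H z != 0 -> exists k, K (translate k z)].

Definition partial_q (R : realType) (n : nat) (H : extended_phase R n -> R)
    (t : R) (q p : 'rV[R]_n) : 'rV[R]_n :=
  \row_i 'D_(delta_mx 0 i) (fun q' : 'rV[R]_n => H (t, q', p)) q.

Definition partial_p (R : realType) (n : nat) (H : extended_phase R n -> R)
    (t : R) (q p : 'rV[R]_n) : 'rV[R]_n :=
  \row_i 'D_(delta_mx 0 i) (fun p' : 'rV[R]_n => H (t, q, p')) p.

(* Difference quotients at t of a path on [0,1]; the filter gives one-sided   *)
(* derivatives at the end points.                                             *)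
Definition quotients01 (R : realType) (n : nat) (x : R -> 'rV[R]_n) (t : R) :=
  (s - t)^-1 *: (x s - x t) @[s --> within `[0, 1]%classic t^'].

Definition velocity (R : realType) (n : nat) (x : R -> 'rV[R]_n) (t : R) :
    'rV[R]_n :=
  lim (quotients01 x t).

(* q is a lift to R^n of the torus component of the solution.                 *)
Definition hamiltonian_solution (R : realType) (n : nat)
    (H : extended_phase R n -> R) (q p : R -> 'rV[R]_n) : Prop :=
  forall t, 0 <= t <= 1 ->
    [/\ enorm (p t) < 1,
        quotients01 q t --> partial_p H t (q t) (p t) &
        quotients01 p t --> - partial_q H t (q t) (p t)].

Definition periodic_in_class (R : realType) (n : nat) (e : 'rV[int]_n)
    (q p : R -> 'rV[R]_n) : Prop :=
  p 1 = p 0 /\ q 1 = q 0 + vecZ R e.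

Definition action (R : realType) (n : nat) (H : extended_phase R n -> R)
    (q p : R -> 'rV[R]_n) : R :=
  \int[lebesgue_measure]_(t in `[0, 1]%classic)
    (H (t, q t, p t) - \sum_(i < n) p t 0 i * velocity q t 0 i).

(* Main.v *)
Require Import Defs.
From HB Require Import structures.
From mathcomp Require Import all_boot all_order all_algebra.
From mathcomp Require Import fingroup perm.
From mathcomp Require Import all_classical all_reals all_analysis.
From mathcomp Require Import zify ring lra.

Set Implicit Arguments.
Unset Strict Implicit.
Unset Printing Implicit Defensive.

Import Order.TTheory GRing.Theory Num.Theory.
Import numFieldNormedType.Exports.

Local Open Scope classical_set_scope.
Local Open Scope ring_scope.

(** Why the theorem holds.

    Let [r < 1] be such that [H] vanishes for [|p| > r].  Outside its domain [H]
    is extended by [0], and the penalty [- B dist(p, ball of radius r)^2] is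
    added to it.  For a time step [1/N] write a loop in the class [e] as
    [q_k = u_k + (k/N) e], [p_k], with [k] cyclic modulo [N]; its action becomes
    the function
      [A(u, p) = sum_k (H - B dist^2 - p_k.e) / N - sum_k p_k.(u_{k+1} - u_k)]
    of finitely many variables, whose critical points are the periodic orbits of
    the symplectic Euler scheme.

    A critical point at a level at least [c] is found by linking.  On the plane
    [p = 0] one has [A >= c], whereas on the fibre [u = 0] the penalty makes [A]
    bounded above and tend to minus infinity.  If the gradient stayed away from [0]
    near and above level [c], finitely many normalised descent steps, switched
    off at low levels, would push the whole fibre strictly below [c].  But the
    [p]-component of the pushed fibre is a continuous map of a Euclidean space
    that is the identity near infinity, so it vanishes somewhere
    ([continuous_zero_of_id_outside]), and there [A >= c]
    ([no_uniform_descent], [almost_critical]).  The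
    invariance under integer translations of [u] then gives the compactness that turns
    almost critical points into critical ones ([critical_point_exists]).

    The inequality [|e| <= c] enters through [critical_radius].  Where
    [|p_k| > r] the force [H_q] is zero, so that one such [k] forces [p] to be
    constant; then the scheme reads [e = - 2 B (p - proj p)], and the action is
    [|e| (|p| + r) / 2], which for [B] large is smaller than [|e|].  Hence a
    critical point of level at least [c] has all [|p_k| <= r], where the penalty
    is zero: it is a discrete orbit of [H] itself ([discrete_orbit]).

    As [N] tends to infinity the discrete orbits are uniformly Lipschitz.  Their
    pointwise limits along a fixed ultrafilter on the integers exist, and an
    estimate for increments that is uniform in [N] shows directly that the limits
    are differentiable with the velocity prescribed by the Hamiltonian system
    ([limit_velocity]).  The partial sums of the discrete action are carried along
    as one more component [S] of the orbit; its limit satisfies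
    [S' = H - p.H_p] and [S 1 - S 0 >= c], and the fundamental theorem of
    calculus identifies [S 1 - S 0] with the action of the limit orbit
    ([limit_orbit], [integral_has_velocity01]).

    The zero theorem of Brouwer type is obtained from Kuhn's triangulation of the
    cube.  The signed count of fully labelled simplices is written as a sum of
    determinants; on a grid that is closed up to a torus it is zero for every
    labelling ([kuhn_degree0]).  The labelling of the given map and that of the
    identity agree on all simplices that cross the seam, and the identity has one
    fully labelled simplex away from the seam, so the given map has one too
    ([kuhn_lemma]). *)

(** * Kuhn's labelling lemma *)

Section KuhnDegree.
Variables (m L : nat).
Notation D := m.+1.
Notation grid := {ffun 'I_D -> 'I_L.+1}.

(** The permutation [s] sends a coordinate to its position in the order in which
    coordinates are incremented, so [kuhn_vertex x s l] is vertex number [l] of the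
    simplex of the Kuhn triangulation with base point [x] and order [s].  The
    increments are cyclic: the grid is a torus. *)
Definition kuhn_vertex (x : grid) (s : 'S_D) (l : nat) : grid :=
  [ffun i => if s i < l then ordS (x i) else x i]%N.

Variable lab : grid -> 'I_D.+1.

(** Up to sign, [\det (label_mx x s)] is the indicator that the simplex carries all
    labels.  The last column is the sum of the indicator columns of all labels
    rather than the indicator of the last one.  This does not change the determinant,
    and expansion along that column becomes a sum over the facets. *)
Definition label_mx (x : grid) (s : 'S_D) : 'M[int]_(D.+1) :=
  \matrix_(l, c) (if c == ord_max then 1 else (lab (kuhn_vertex x s l) == c)%:R).

Definition facet (j : 'I_D.+1) (s : 'S_D) (x : grid) : int :=
  \det (row' j (col' ord_max (label_mx x s))).

Lemma facetE j s x : facet j s x =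
  \det (\matrix_(l < D, c < D) (lab (kuhn_vertex x s (lift j l)) == lift ord_max c)%:R).
Proof.
congr (\det _); apply/matrixP=> l c; rewrite !mxE.
by rewrite eq_sym (negPf (neq_lift _ _)).
Qed.

(** The facet opposite an inner vertex is shared by the two simplices whose orders
    differ by the transposition [tau] of positions [j - 1] and [j]; they enter the
    sum with opposite signs. *)
Lemma facet_inner (j : 'I_D.+1) : (0 < j < D)%N ->
  \sum_(s : 'S_D) \sum_x (-1) ^+ s * facet j s x = 0.
Proof.
case/andP=> j0 jD.
have jD1 : (j.-1 < D)%N by lia.
pose tau := tperm (Ordinal jD1) (Ordinal jD).
have Etau (k : 'I_D) (l : nat) : l != j -> (tau k < l)%N = (k < l)%N.
  by move=> lj; rewrite /tau; case: tpermP => [->|->|//] /=; lia.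
set S := \sum_s _.
suff: S = - S by lia.
rewrite {1}/S (reindex_inj (mulIg tau)) /= /S -sumrN; apply: eq_bigr => s _.
rewrite -sumrN; apply: eq_bigr => x _; rewrite odd_permM odd_tperm.
have -> : Ordinal jD1 != Ordinal jD by rewrite -val_eqE /=; lia.
rewrite signr_addb expr1 mulrN1 mulNr !facetE; congr (- (_ * \det _)).
apply/matrixP=> l c; rewrite !mxE; congr ((lab _ == _)%:R).
apply/ffunP=> i; rewrite !ffunE permM Etau //.
by have := neq_lift j l; rewrite -val_eqE eq_sym.
Qed.

Lemma kuhn_vertex1_inj (s : 'S_D) : injective (fun x => kuhn_vertex x s 1).
Proof.
move=> x y /ffunP E; apply/ffunP=> i; have := E i; rewrite !ffunE.
by case: ifP => // _; apply: ordS_inj.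
Qed.

(** The facet of [(x, s)] opposite its first vertex is the facet opposite the last
    vertex of the simplex based at the second vertex of [(x, s)], with the order
    rotated by [rho]. *)
Lemma facet_outer :
  \sum_(s : 'S_D) \sum_x (-1) ^+ s * facet ord_max s x =
  (-1) ^+ m * \sum_(s : 'S_D) \sum_x (-1) ^+ s * facet ord0 s x.
Proof.
pose rho : 'S_D := lift_perm ord0 ord_max 1.
rewrite (reindex_inj (mulIg rho)) /= big_distrr; apply: eq_bigr => s _ /=.
rewrite (reindex_inj (@kuhn_vertex1_inj s)) /= big_distrr; apply: eq_bigr => x _ /=.
rewrite odd_permM odd_lift_perm odd_perm1 /= addbF signr_addb signr_odd.
rewrite -mulrA [RHS]mulrCA !facetE; congr (_ * (_ * \det _)).
apply/matrixP=> l c; rewrite !mxE; congr ((lab _ == _)%:R).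
apply/ffunP=> i; rewrite !ffunE permM.
rewrite lift_max.
case: (unliftP ord0 (s i)) => [k ->|->].
  rewrite lift_perm_lift perm1 lift_max /= /bump /=.
  by rewrite ltnS.
rewrite lift_perm_id /=.
by rewrite ltnNge -ltnS ltn_ord.
Qed.

(** A torus has no boundary, so all facets cancel in pairs. *)
Lemma kuhn_degree0 :
  \sum_(s : 'S_D) \sum_x (-1) ^+ s * \det (label_mx x s) = 0.
Proof.
have E (s : 'S_D) x : (-1) ^+ s * \det (label_mx x s) =
    \sum_(j < D.+1) (-1) ^+ (j + D) * ((-1) ^+ s * facet j s x).
  rewrite (expand_det_col _ ord_max) big_distrr; apply: eq_bigr => j _ /=.
  by rewrite mxE eqxx mul1r /cofactor mulrCA.
under eq_bigr => s _ do under eq_bigr => x _ do rewrite E.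
under eq_bigr => s _ do rewrite exchange_big /=.
rewrite exchange_big /=.
under eq_bigr => j _ do under eq_bigr => s _ do rewrite -mulr_sumr.
under eq_bigr => j _ do rewrite -mulr_sumr.
rewrite big_ord_recr big_ord_recl /= facet_outer.
rewrite [X in _ + X + _]big1 ?addr0; last first.
  move=> j _; rewrite (_ : widen_ord _ _ = lift ord0 (widen_ord (leqnSn _) j)).
    by rewrite facet_inner ?mulr0 // lift0 /= ltnS ltn_ord.
  exact: val_inj.
rewrite (_ : widen_ord _ _ = ord0); last exact: val_inj.
rewrite mulrA -mulrDl /= add0n -[(-1) ^+ (D + D)]signr_odd oddD addbb expr0 mul1r.
by rewrite exprS mulN1r addNr mul0r.
Qed.

Lemma label_mx_rainbow x s :
  \det (label_mx x s) != 0 -> injective (fun l : 'I_D.+1 => lab (kuhn_vertex x s l)).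
Proof.
move=> d0 l1 l2 E; apply/eqP; apply: contraNT d0 => l12.
by apply/eqP; apply: (determinant_alternate l12) => c; rewrite !mxE E.
Qed.

End KuhnDegree.

Section KuhnLemma.
Variables (m L : nat).
Notation D := m.+1.
Notation grid := {ffun 'I_D -> 'I_L.+1}.

Definition first_fail (pos : grid -> pred 'I_D) (a : grid) : 'I_D.+1 :=
  inord (find (fun i => ~~ pos a i) (enum 'I_D)).

Lemma first_failE pos a :
  first_fail pos a = find (fun i => ~~ pos a i) (enum 'I_D) :> nat.
Proof.
by rewrite inordK // ltnS -[leqRHS](size_enum_ord D) find_size.
Qed.

Lemma first_fail_before pos a (i : 'I_D) : (i < first_fail pos a)%N -> pos a i.
Proof.
rewrite first_failE => /(before_find i) /negbFE.
by rewrite nth_ord_enum.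
Qed.

Lemma first_fail_at pos a (i : 'I_D) : i = first_fail pos a :> nat -> ~~ pos a i.
Proof.
rewrite first_failE => E.
have := @nth_find _ i (fun i => ~~ pos a i) (enum 'I_D).
by rewrite -E nth_ord_enum; apply; rewrite has_find -E size_enum_ord.
Qed.

Lemma inj_homo_ord n (f : 'I_n -> 'I_n) :
  injective f -> {homo f : i j / (i <= j)%N} -> forall i, f i = i.
Proof.
move=> fi fh.
have fs (i j : 'I_n) : (i < j)%N -> (f i < f j)%N.
  move=> ij; rewrite ltn_neqAle fh ?(ltnW ij) // andbT val_eqE (inj_eq fi).
  by rewrite -val_eqE /= ltn_eqF.
have up (k : nat) (i : 'I_n) : i = k :> nat -> (i <= f i)%N.
  elim: k i => [|k IH] i ik; first by rewrite ik.
  have kn : (k < n)%N by have := ltn_ord i; lia.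
  have ki : (Ordinal kn < i)%N by rewrite ik /=.
  by have := IH (Ordinal kn) erefl; have := fs _ _ ki => /=; lia.
have dn (k : nat) (i : 'I_n) : (n - i = k)%N -> (f i <= i)%N.
  elim: k i => [|k IH] i ik; first by have := ltn_ord i; lia.
  have [e|ne] := eqVneq i.+1 n; first by have := ltn_ord (f i); lia.
  have kn : (i.+1 < n)%N by have := ltn_ord i; lia.
  have E : (n - i.+1 = k)%N by lia.
  by have := IH (Ordinal kn) E; have := fs i (Ordinal kn) (ltnSn i) => /=; lia.
by move=> i; apply/val_inj/eqP; rewrite eqn_leq (up _ i erefl) (dn _ i erefl).
Qed.

Variable a0 : nat.
Hypothesis a0L : (a0 < L)%N.

Let pos0 (a : grid) : pred 'I_D := fun i => (a0 < a i)%N.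
Let interior (x : grid) := [forall i, x i < L]%N.

Lemma kuhn_vertex_interior (x : grid) (s : 'S_D) l i : interior x ->
  kuhn_vertex x s l i = (x i + (s i < l))%N :> nat.
Proof.
move=> /forallP /(_ i) xi; rewrite ffunE; case: ifP => _ /=; rewrite ?addn0 //.
by rewrite addn1 modn_small // ltnS.
Qed.

Let x0 : grid := [ffun=> inord a0].

Lemma x0_interior : interior x0.
Proof. by apply/forallP=> i; rewrite ffunE inordK // (ltn_trans a0L). Qed.

Lemma x0E i : x0 i = a0 :> nat.
Proof. by rewrite ffunE inordK // (ltn_trans a0L). Qed.

(** Along a simplex that does not wrap around the coordinates increase, hence so do
    the labels of the identity; if they are distinct, vertex [l] has label [l], and
    this pins down both the base point and the order. *)
Lemma pos0_rainbow x s : interior x ->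
  injective (fun l : 'I_D.+1 => first_fail pos0 (kuhn_vertex x s l)) ->
  x = x0 /\ s = 1%g.
Proof.
move=> xi linj.
have lid : forall l : 'I_D.+1, first_fail pos0 (kuhn_vertex x s l) = l.
  apply: inj_homo_ord => // l1 l2 l12; rewrite leqNgt; apply/negP => lt.
  have lD : (first_fail pos0 (kuhn_vertex x s l2) < D)%N.
    by rewrite (leq_trans lt) // -ltnS ltn_ord.
  have := @first_fail_before pos0 (kuhn_vertex x s l1) (Ordinal lD) lt.
  have := @first_fail_at pos0 (kuhn_vertex x s l2) (Ordinal lD) erefl.
  rewrite /pos0 !kuhn_vertex_interior //.
  by move: (s _) (x _) => k y; lia.
have P (i : 'I_D) (l : 'I_D.+1) : (i < l)%N -> (a0 < x i + (s i < l))%N.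
  rewrite -{1}(lid l) => /first_fail_before.
  by rewrite /pos0 kuhn_vertex_interior.
have Q (i : 'I_D) (l : 'I_D.+1) : i = l :> nat -> (x i + (s i < l) <= a0)%N.
  rewrite -{1}(lid l) => /first_fail_at.
  by rewrite /pos0 kuhn_vertex_interior // -leqNgt.
have xs (i : 'I_D) : x i = a0 :> nat /\ s i = i.
  have := P i (lift ord0 i); rewrite lift0 ltnSn => /(_ isT).
  have := Q i (widen_ord (leqnSn _) i) erefl => /=.
  have -> : (s i = i) <-> (s i = i :> nat) by split=> [->|/val_inj].
  by lia.
split.
  by apply/ffunP=> i; apply/ord_inj; rewrite x0E; case: (xs i).
by apply/permP=> i; rewrite perm1; case: (xs i).
Qed.

Lemma pos0_det : \det (label_mx (first_fail pos0) x0 1) = 1.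
Proof.
have lE (l : 'I_D.+1) : first_fail pos0 (kuhn_vertex x0 1 l) = l.
  have pE (i : 'I_D) : pos0 (kuhn_vertex x0 1 l) i = (i < l)%N.
    rewrite /pos0 kuhn_vertex_interior ?x0_interior // x0E perm1; lia.
  apply/val_inj/eqP => /=; rewrite eqn_leq leqNgt [X in _ && X]leqNgt.
  apply/andP; split; apply/negP => h.
    have lD : (l < D)%N by rewrite (leq_trans h) // -ltnS ltn_ord.
    have := @first_fail_before pos0 (kuhn_vertex x0 1 l) (Ordinal lD) h.
    by rewrite pE /= ltnn.
  have lD : (first_fail pos0 (kuhn_vertex x0 1 l) < D)%N.
    by rewrite (leq_trans h) // -ltnS ltn_ord.
  have := @first_fail_at pos0 (kuhn_vertex x0 1 l) (Ordinal lD) erefl.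
  by rewrite pE h.
rewrite -det_tr det_trig; last first.
  apply/is_trig_mxP => c l cl; rewrite !mxE lE -val_eqE /=.
  rewrite ltn_eqF; last by rewrite (leq_trans cl) // -ltnS.
  by rewrite -val_eqE /= gtn_eqF.
by rewrite big1 // => c _; rewrite !mxE lE eqxx; case: ifP.
Qed.

(** By [kuhn_degree0] the signed count of fully labelled simplices is zero both for
    [pos] and for the signs of [a i - a0].  Simplices that wrap around contribute the
    same to both counts, and the others contribute [1] to the second; hence some of
    them is fully labelled for [pos].  Its vertex with the last label has all signs
    positive, and its vertex with label [i] has sign number [i] not positive. *)
Lemma kuhn_lemma (pos : grid -> pred 'I_D) :
  (forall a : grid, [exists i, (a i == ord0) || (a i == ord_max)] -> pos a =1 pos0 a) ->
  exists (x : grid) (s : 'S_D),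
    [/\ forall i, (x i < L)%N,
        exists l : 'I_D.+1, forall i, pos (kuhn_vertex x s l) i &
        forall i, exists l : 'I_D.+1, ~~ pos (kuhn_vertex x s l) i].
Proof.
move=> bd.
pose F p (x : grid) (s : 'S_D) : int := (-1) ^+ s * \det (label_mx (first_fail p) x s).
have F0 p : \sum_x \sum_s F p x s = 0.
  by rewrite exchange_big /=; exact: (kuhn_degree0 (first_fail p)).
(* every vertex of a simplex that wraps around has an extreme coordinate *)
have Fwrap x s : ~~ interior x -> F pos x s = F pos0 x s.
  rewrite negb_forall => /existsP[i]; rewrite -leqNgt => iL.
  congr (_ * \det _); apply/matrixP=> l c; rewrite !mxE.
  congr (if _ then _ else (_ == _)%:R).
  have E : pos (kuhn_vertex x s l) =1 pos0 (kuhn_vertex x s l).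
    apply: bd; apply/existsP; exists i; rewrite ffunE.
    have -> : x i = ord_max.
      by apply/val_inj => /=; apply/eqP; rewrite eqn_leq iL -ltnS ltn_ord.
    case: ifP => _; last by rewrite eqxx orbT.
    by rewrite -val_eqE /= modnn.
  by congr inord; apply: eq_find => j; rewrite E.
have Fint : \sum_(x | interior x) \sum_s F pos0 x s = 1.
  rewrite (bigD1 x0) ?x0_interior //= (bigD1 1%g) //= /F odd_perm1 pos0_det.
  rewrite mulr1 big1 ?big1 ?addr0 //.
    move=> x /andP[xi xx0]; rewrite big1 // => s _; apply/eqP.
    rewrite mulf_eq0 signr_eq0 /=; apply: contraNT xx0 => /label_mx_rainbow h.
    by rewrite (proj1 (pos0_rainbow xi h)).
  move=> s s1; apply/eqP; rewrite mulf_eq0 signr_eq0 /=.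
  apply: contraNT s1 => /label_mx_rainbow h.
  by rewrite (proj2 (pos0_rainbow x0_interior h)).
have: \sum_(x | interior x) \sum_s F pos x s != 0.
  have := F0 pos; rewrite (bigID interior) /= => /eqP; rewrite addr_eq0 => /eqP->.
  have := F0 pos0; rewrite (bigID interior) /= Fint => /eqP; rewrite addr_eq0.
  move=> /eqP E; rewrite oppr_eq0 (eq_bigr (fun x => \sum_s F pos0 x s)).
    by apply/eqP => E0; move: E; rewrite E0 oppr0.
  by move=> x xi; apply: eq_bigr => s _; exact: Fwrap.
have [[x [s [xi Fx]]] _|H] :
    (exists x s, interior x /\ F pos x s != 0) \/
    ~ (exists x s, interior x /\ F pos x s != 0).
  - case: (boolP [exists x, exists s, interior x && (F pos x s != 0)]).
      by move=> /existsP[x /existsP[s /andP[]]]; left; exists x, s.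
    move=> h; right => -[x [s [h1 h2]]]; case/negP: h.
    by apply/existsP; exists x; apply/existsP; exists s; rewrite h1 h2.
  - exists x, s; move: Fx; rewrite mulf_eq0 signr_eq0 /= => /label_mx_rainbow.
    move=> /injF_bij [g _ gK]; split.
    + by move=> i; exact: (forallP xi).
    + exists (g ord_max) => i; apply: first_fail_before.
      by rewrite gK.
    + move=> i; exists (g (widen_ord (leqnSn _) i)); apply: first_fail_at.
      by rewrite gK.
rewrite big1 ?eqxx // => x xi; rewrite big1 // => s _; apply/eqP.
by apply: contraT => h; case: H; exists x, s.
Qed.

End KuhnLemma.

(** * Ultrafilter limits and a zero theorem of Brouwer type *)

Section ContinuousMaps.
Variables S T W : topologicalType.

Lemma continuous_compose (f : S -> T) (g : T -> W) :
  continuous f -> continuous g -> continuous (fun x => g (f x)).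
Proof. by move=> fc gc x; exact: (continuous_comp (fc x) (gc _)). Qed.

Lemma continuous_pair (f : S -> T) (g : S -> W) :
  continuous f -> continuous g -> continuous (fun x => (f x, g x)).
Proof. by move=> fc gc x; apply: cvg_pair; [exact: fc|exact: gc]. Qed.

Lemma continuous_fst : continuous (fst : T * W -> T).
Proof. by move=> x; exact: cvg_fst. Qed.

Lemma continuous_snd : continuous (snd : T * W -> W).
Proof. by move=> x; exact: cvg_snd. Qed.

End ContinuousMaps.

Lemma continuous_sum (K : numFieldType) (V : normedModType K) (T : topologicalType)
    (I : Type) (s : seq I) (f : I -> T -> V) :
  (forall i, continuous (f i)) -> continuous (fun x => \sum_(i <- s) f i x).
Proof.
by move=> fc; apply: continuous_big => [|i _]; [exact: add_continuous|exact: fc].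
Qed.

Section MatrixNorm.
Variable R : realType.

Lemma le_mx_norm m n (A : 'M[R]_(m, n)) i j : `|A i j| <= `|A|.
Proof.
rewrite [leRHS]/Num.norm /= mx_normrE.
by apply/bigmax_geP; right; exists (i, j).
Qed.

Lemma mx_norm_leP m n (A : 'M[R]_(m, n)) (c : R) : 0 <= c ->
  reflect (forall i j, `|A i j| <= c) (`|A| <= c).
Proof.
move=> c0; apply: (iffP idP) => [Ac i j|Ac]; first exact: le_trans (le_mx_norm _ _ _) Ac.
by rewrite [leLHS]/Num.norm /= mx_normrE; apply/bigmax_leP; split => // -[i j] _.
Qed.

Lemma cvg_mx (T : Type) (F : set_system T) {FF : Filter F} m n
    (f : T -> 'M[R]_(m, n)) (l : 'M[R]_(m, n)) :
  (forall i j, f x i j @[x --> F] --> l i j) -> f @ F --> l.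
Proof.
move=> fl; apply/cvgrPdist_le => e e0.
have : \forall x \near F, forall ij : 'I_m * 'I_n, `|l ij.1 ij.2 - f x ij.1 ij.2| <= e.
  apply: filter_forall => -[i j] /=.
  by move/cvgrPdist_le : (fl i j) => /(_ e e0).
apply: filterS => x fx; apply/mx_norm_leP; first exact: ltW.
by move=> i j; have := fx (i, j); rewrite !mxE.
Qed.

Lemma cvg_mxE (T : Type) (F : set_system T) {FF : Filter F} m n
    (f : T -> 'M[R]_(m, n)) (l : 'M[R]_(m, n)) i j :
  f @ F --> l -> f x i j @[x --> F] --> l i j.
Proof.
by move=> fl; apply: (cvg_comp _ (fun M : 'M[R]_(m, n) => M i j) fl); exact: coord_continuous.
Qed.

Lemma continuous_mx (T : topologicalType) m n (f : T -> 'M[R]_(m, n)) :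
  (forall i j, continuous (fun x => f x i j)) -> continuous f.
Proof. by move=> fc x; apply: cvg_mx => i j; exact: fc. Qed.

End MatrixNorm.

Section UltraLimit.
Variable R : realType.

(** Bounded sequences converge along an ultrafilter.  This serves as a choice of
    subsequence that works for uncountably many sequences at once, one for every
    time of the unit interval. *)
Lemma ultra_nat : exists U : set_system nat, UltraFilter U /\ \oo `<=` U.
Proof. by have [U] := @ultraFilterLemma nat \oo _; exists U. Qed.

Variables (U : set_system nat) (UU : UltraFilter U) (oU : \oo `<=` U).

Lemma ultra_cvg (T : topologicalType) (f : nat -> T) (l : T) :
  f @ \oo --> l -> f @ U --> l.
Proof. by move=> fl A /fl; exact: oU. Qed.

Lemma ultra_cvg_bounded (y : nat -> R) (B : R) :
  (forall k, `|y k| <= B) -> exists l : R, y @ U --> l.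
Proof.
move=> yB.
have K : (y @ U) `[- B, B]%classic.
  by apply: (@filterE _ U) => k; rewrite /= in_itv /= -ler_norml.
have [l [_ lc]] := @segment_compact R (- B) B (y @ U) _ K.
exists l => A lA.
have [//|nA] := in_ultra_setVsetC (y @^-1` A) UU.
by have [z []] := lc (~` A) A nA lA.
Qed.

Lemma ultra_cvg_bounded_mx m n (y : nat -> 'M[R]_(m, n)) (B : R) :
  (forall k i j, `|y k i j| <= B) -> exists l : 'M[R]_(m, n), y @ U --> l.
Proof.
move=> yB.
have H i j : {l : R | (fun k => y k i j) @ U --> l}.
  by apply: cid; apply: (@ultra_cvg_bounded (fun k => y k i j) B) => k; exact: yB.
exists (\matrix_(i, j) sval (H i j)); apply: cvg_mx => i j; rewrite mxE.
exact: svalP (H i j).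
Qed.

End UltraLimit.

Section Brouwer.
Variable R : realType.

Lemma cvg_near_mx (U : set_system nat) {UU : ProperFilter U} (oU : \oo `<=` U)
  m n (z w : nat -> 'M[R]_(m, n)) (c : R) (l : 'M[R]_(m, n)) :
  (forall k, `|w k - z k| <= c / k.+1%:R) -> z @ U --> l -> w @ U --> l.
Proof.
move=> wz zl.
have -> : w = (w - z) + z by rewrite subrK.
rewrite -[l]add0r; apply: cvgD => //.
apply: (ultra_cvg oU).
apply/cvgr0Pnorm_le => e e0.
have := @near_infty_natSinv_lt R (PosNum (divr_gt0 e0 (ltr_pwDr ltr01 (normr_ge0 c)))).
apply: filterS => k /= /ltW kc; apply: (le_trans (wz k)).
have c0 : 0 < `|c| + 1 by rewrite ltr_pwDr.
rewrite -(@ler_pM2l _ (`|c| + 1)) // mulrCA divff ?gt_eqF // mulr1 in kc.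
by apply: le_trans kc; rewrite ler_wpM2r ?invr_ge0 // (le_trans (ler_norm c)) // lerDl.
Qed.

(** The points of the grid with [2 (k + 1) + 1] values per coordinate fill the cube
    of half-width [r], on whose boundary [f] is the identity.  Kuhn's lemma yields
    a small simplex at whose vertices every component of [f] takes both signs; as
    the mesh tends to [0] these simplices accumulate at a zero. *)
Theorem continuous_zero_of_id_outside m (r : R) (f : 'rV[R]_m -> 'rV[R]_m) :
  continuous f -> (forall x, r <= `|x| -> f x = x) -> exists x, f x = 0.
Proof.
case: m f => [|m] f fc fid.
  by exists 0; apply/rowP => -[].
wlog r0 : r fid / 0 < r.
  move=> W; have [|r0] := ltP 0 r; first exact: W fid.
  apply: (W 1) => // x x1; apply: fid; exact: le_trans r0 (le_trans ler01 x1).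
pose pt k (a : {ffun 'I_m.+1 -> 'I_(k.+1.*2).+1}) : 'rV[R]_m.+1 :=
  \row_i (((a i)%:R / k.+1%:R - 1) * r).
have grid k : exists z : 'rV[R]_m.+1 * ('rV[R]_m.+1 * ('I_m.+1 -> 'rV[R]_m.+1)),
    [/\ forall i, `|z.1 0 i| <= r,
        `|z.2.1 - z.1| <= r / k.+1%:R /\ forall i, 0 <= f z.2.1 0 i &
        forall i, `|z.2.2 i - z.1| <= r / k.+1%:R /\ f (z.2.2 i) 0 i <= 0].
  have k0 : (k.+1%:R : R) > 0 by rewrite ltr0n.
  have a0L : (k.+1 < k.+1.*2)%N by lia.
  have [|x [s [xL [l0 Pl0] Pl]]] := @kuhn_lemma m _ k.+1 a0L (fun a i => 0 < f (pt k a) 0 i).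
    move=> a /existsP[i ai] j.
    have -> : f (pt k a) = pt k a.
      apply: fid; apply: le_trans (le_mx_norm _ 0 i); rewrite mxE.
      rewrite normrM (gtr0_norm r0) ler_peMl ?(ltW r0) //.
      case/orP: ai => /eqP -> /=; first by rewrite mul0r add0r normrN1.
      by rewrite -muln2 natrM mulrAC divff ?gt_eqF // mul1r -[2]/(1 + 1) addrK normr1.
    by rewrite mxE pmulr_lgt0 // subr_gt0 ltr_pdivlMr // mul1r ltr_nat.
  have close l : `|pt k (kuhn_vertex x s l) - pt k x| <= r / k.+1%:R.
    apply/mx_norm_leP; first by rewrite divr_ge0 // ltW.
    move=> i j; rewrite !mxE -mulrBl opprB addrA subrK -mulrBl ffunE.
    case: ifP => _; last by rewrite subrr !mul0r normr0 divr_ge0 // ltW.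
    rewrite [nat_of_ord (ordS _)]modn_small; last by have := xL j; rewrite -ltnS.
    rewrite -addn1 natrD addrAC subrr add0r mul1r mulrC.
    by rewrite ger0_norm // divr_ge0 // ltW.
  have cPl i : {l | ~~ (0 < f (pt k (kuhn_vertex x s l)) 0 i)}.
    by have /cid[l hl] := Pl i; exists l.
  exists (pt k x, (pt k (kuhn_vertex x s l0), fun i => pt k (kuhn_vertex x s (sval (cPl i))))).
  split => /=.
  - move=> i; rewrite mxE normrM (gtr0_norm r0) ler_piMl ?(ltW r0) //.
    rewrite ler_norml; have := xL i; set y := x i => yL.
    rewrite lerBrDr addNr divr_ge0 //= lerBlDr ler_pdivrMr //.
    by rewrite -[1 + 1]/(2%:R) -natrM ler_nat mul2n ltnW.
  - by split => // i; exact/ltW/Pl0.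
  - by move=> i; split => //; rewrite leNgt; exact: svalP (cPl i).
have /choice[z zP] := grid.
have [U [UU oU]] := ultra_nat.
have [l zl] : exists l : 'rV[R]_m.+1, (fun k => (z k).1) @ U --> l.
  apply: (@ultra_cvg_bounded_mx _ _ _ _ _ _ r) => k i j.
  by rewrite ord1; case: (zP k).
exists l; apply/rowP => i; rewrite mxE; apply/eqP; rewrite eq_le; apply/andP; split.
- have wl : (fun k => (z k).2.2 i) @ U --> l.
    by apply: (@cvg_near_mx U _ oU _ _ _ _ r _ _ zl) => k; case: (zP k) => _ _ /(_ i)[].
  have : f ((z k).2.2 i) 0 i @[k --> U] --> f l 0 i.
    exact: cvg_mxE (cvg_comp _ _ wl (fc l)).
  by move/cvgr_to_le; apply; apply: filterE => k; case: (zP k) => _ _ /(_ i)[].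
- have wl : (fun k => (z k).2.1) @ U --> l.
    by apply: (@cvg_near_mx U _ oU _ _ _ _ r _ _ zl) => k; case: (zP k) => _ [].
  have : f ((z k).2.1) 0 i @[k --> U] --> f l 0 i.
    exact: cvg_mxE (cvg_comp _ _ wl (fc l)).
  by move/cvgr_to_ge; apply; apply: filterE => k; case: (zP k) => _ [].
Qed.

End Brouwer.

(** * Deformation of a fibre past a Lagrangian plane *)

Section BrouwerMx.
Variable R : realType.

Lemma mx_norm_mxvec N n (A : 'M[R]_(N, n)) : `|mxvec A| = `|A|.
Proof.
apply/eqP; rewrite eq_le; apply/andP; split; apply/mx_norm_leP => //.
  by move=> i j; case/mxvec_indexP: j => k l; rewrite ord1 mxvecE le_mx_norm.
by move=> k l; rewrite -(mxvecE A); exact: le_mx_norm.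
Qed.

Corollary continuous_zero_of_id_outside_mx N n (r : R)
    (f : 'M[R]_(N, n) -> 'M[R]_(N, n)) :
  continuous f -> (forall x, r <= `|x| -> f x = x) -> exists x, f x = 0.
Proof.
move=> fc fid.
have vc : continuous (vec_mx : 'rV[R]_(N * n) -> 'M[R]_(N, n)).
  apply: continuous_mx => i j x; rewrite (_ : (fun _ => _) = fun y : 'rV[R]_(N * n) => y 0 (mxvec_index i j)).
    exact: coord_continuous.
  by apply/funext => y; rewrite mxE.
have mc : continuous (mxvec : 'M[R]_(N, n) -> 'rV[R]_(N * n)).
  apply: continuous_mx => i j x; case/mxvec_indexP: j => k l.
  rewrite (_ : (fun _ => _) = fun y : 'M[R]_(N, n) => y k l).
    exact: coord_continuous.
  by apply/funext => y; rewrite ord1 mxvecE.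
have [|x rx|x /eqP] := @continuous_zero_of_id_outside R _ r (fun x => mxvec (f (vec_mx x))).
- by move=> x; exact: (continuous_comp (continuous_comp (vc x) (fc _)) (mc _)).
- by rewrite fid ?vec_mxK // -mx_norm_mxvec vec_mxK.
- by rewrite mxvec_eq0 => /eqP; exists (vec_mx x).
Qed.

End BrouwerMx.

Section Deformation.
Variables (R : realType) (E : normedModType R) (N n : nat).
Notation X := (E * 'M[R]_(N, n))%type.
Variables (A : X -> R) (V : X -> X) (a b c r delta kappa : R).
Hypotheses (A_cont : continuous A) (V_cont : continuous V).
Hypotheses (ac : a < c) (delta0 : 0 < delta) (kappa0 : 0 < kappa).
Hypothesis descent : forall x s, a < A x -> 0 <= s <= delta ->
  A (x + s *: V x) <= A x - s * kappa.
Hypothesis A_axis : forall u, c <= A (u, 0).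
Hypothesis A_le : forall P, A (0, P) <= b.
Hypothesis A_far : forall P, r <= `|P| -> A (0, P) <= a.

Let mu := (c - a) / 2.
Let mu0 : 0 < mu. Proof. by rewrite divr_gt0 // subr_gt0. Qed.

Let cutoff (y : R) : R := Num.max 0 (Num.min 1 ((y - a) / mu)).

Let cutoff01 y : 0 <= cutoff y <= 1.
Proof. by rewrite /cutoff le_max lexx /= ge_max ler01 ge_min lexx. Qed.

Let cutoff_low y : y <= a -> cutoff y = 0.
Proof.
move=> ya; rewrite /cutoff; apply/max_idPl; rewrite ge_min; apply/orP; right.
by rewrite pmulr_lle0 ?invr_gt0 // subr_le0.
Qed.

Let cutoff_high y : a + mu <= y -> cutoff y = 1.
Proof.
move=> ya; rewrite /cutoff.
have h : 1 <= (y - a) / mu by rewrite ler_pdivlMr // mul1r lerBrDl.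
by rewrite (min_idPl h); apply/max_idPr.
Qed.

Let push x := x + (delta * cutoff (A x)) *: V x.

Let push_cont : continuous push.
Proof.
have cc : continuous cutoff.
  have -> : cutoff = (cst 0) \max ((cst 1) \min (fun y => (y - a) / mu)) by [].
  apply: max_fun_continuous => [|y]; first exact: cst_continuous.
  apply: continuous_min; first exact: cst_continuous.
  by apply: cvgM; [apply: cvgB; [exact: cvg_id|exact: cvg_cst]|exact: cvg_cst].
move=> x; rewrite /push; apply: cvgD; first exact: cvg_id.
apply: cvgZ; last exact: V_cont.
apply: cvgM; first exact: cvg_cst.
by apply: (cvg_comp A cutoff); [exact: A_cont|exact: cc].
Qed.

Let push_le x : A (push x) <= A x - delta * cutoff (A x) * kappa.
Proof.
have [xa|ax] := leP (A x) a.
  by rewrite /push cutoff_low // mulr0 scale0r addr0 mul0r subr0.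
apply: descent => //; have /andP[c0 c1] := cutoff01 (A x).
by rewrite mulr_ge0 ?(ltW delta0) //= ler_piMr // ltW.
Qed.

Let iter_push_le x j :
  A (iter j push x) <= Num.max (a + mu) (A x - j%:R * (delta * kappa)).
Proof.
elim: j => [|j IH] /=; first by rewrite mul0r subr0 le_max lexx orbT.
set y := iter j push x in IH *.
have [yh|yl] := leP (a + mu) (A y).
  move: (push_le y); rewrite cutoff_high // mulr1.
  move: IH; rewrite le_max => /orP[IH|IH] h; rewrite le_max; apply/orP.
    left; apply: le_trans h _; apply: le_trans IH.
    by rewrite lerBlDr lerDl mulr_ge0 // ltW.
  right; apply: le_trans h _; rewrite -natr1 mulrDl mul1r opprD addrA lerD2r //.
rewrite le_max; apply/orP; left; apply: le_trans (push_le y) _.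
rewrite lerBlDr; apply: le_trans (ltW yl) _; rewrite lerDl.
by rewrite !mulr_ge0 ?(ltW delta0) ?(ltW kappa0) //; case/andP: (cutoff01 (A y)).
Qed.

(** The descent step [push] is the identity below level [a] and lowers the level by a
    fixed amount above [a + mu], where [a + mu < c].  After enough steps the whole
    fibre [(0, P)] lies at or below [a + mu], although it has not moved for large
    [P]; its second component therefore vanishes somewhere, which contradicts the
    lower bound [c] on the plane [(u, 0)]. *)
Lemma no_uniform_descent : False.
Proof.
have dk0 : 0 < delta * kappa by rewrite mulr_gt0.
pose M := (Num.truncn ((b - (a + mu)) / (delta * kappa))).+1.
have bM : b - M%:R * (delta * kappa) <= a + mu.
  by rewrite lerBlDr -lerBlDl -ler_pdivrMr // ltW // truncnS_gt.
have ic : continuous (iter M push).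
  elim: (M) => [|j IH] x; first exact: cvg_id.
  by apply: (cvg_comp (iter j push) push); [exact: IH|exact: push_cont].
pose f (P : 'M[R]_(N, n)) := (iter M push (0, P)).2.
have [|P rP|P fP] := @continuous_zero_of_id_outside_mx R N n r f.
- have pc : continuous (fun P : 'M[R]_(N, n) => (0 : E, P)).
    apply: continuous_pair; [exact: cst_continuous|exact: (fun P => cvg_id)].
  exact: (continuous_compose (continuous_compose pc ic) (@continuous_snd _ _)).
- rewrite /f (_ : iter M push _ = (0, P)) //.
  elim: (M) => //= j ->; rewrite /push cutoff_low ?A_far //.
  by rewrite mulr0 scale0r addr0.
have := iter_push_le (0, P) M; set x := iter M push (0, P).
have -> : x = (x.1, 0) by rewrite -fP [LHS]surjective_pairing.
move=> h; have := le_trans (A_axis x.1) h; rewrite leNgt => /negP; apply.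
have amu : a + mu < c by rewrite -ltrBrDl ltr_pdivrMr // mulr_natr mulr2n ltrDl subr_gt0.
rewrite gt_max amu; apply: le_lt_trans amu.
by apply: le_trans bM; rewrite lerD2r A_le.
Qed.

End Deformation.

(** * Euclidean geometry of the momentum ball *)

Section DotProduct.
Variables (R : realType) (n : nat).
Implicit Types x y z : 'rV[R]_n.

Definition dot x y : R := \sum_i x 0 i * y 0 i.

Lemma dotC x y : dot x y = dot y x.
Proof. by apply: eq_bigr => i _; rewrite mulrC. Qed.

Lemma dotDl x y z : dot (x + y) z = dot x z + dot y z.
Proof. by rewrite -big_split; apply: eq_bigr => i _; rewrite mxE mulrDl. Qed.

Lemma dotZl c x y : dot (c *: x) y = c * dot x y.
Proof. by rewrite mulr_sumr; apply: eq_bigr => i _; rewrite mxE mulrA. Qed.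

Lemma dotNl x y : dot (- x) y = - dot x y.
Proof. by rewrite -scaleN1r dotZl mulN1r. Qed.

Lemma dotBl x y z : dot (x - y) z = dot x z - dot y z.
Proof. by rewrite dotDl dotNl. Qed.

Lemma dotDr x y z : dot x (y + z) = dot x y + dot x z.
Proof. by rewrite dotC dotDl !(dotC x). Qed.

Lemma dotZr c x y : dot x (c *: y) = c * dot x y.
Proof. by rewrite dotC dotZl dotC. Qed.

Lemma dotNr x y : dot x (- y) = - dot x y.
Proof. by rewrite dotC dotNl dotC. Qed.

Lemma dotBr x y z : dot x (y - z) = dot x y - dot x z.
Proof. by rewrite dotDr dotNr. Qed.

Lemma dot0l y : dot 0 y = 0.
Proof. by rewrite -(scale0r 0) dotZl mul0r. Qed.

Lemma dot_ge0 x : 0 <= dot x x.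
Proof. by apply: sumr_ge0 => i _; rewrite -expr2 sqr_ge0. Qed.

Lemma dot_le_norm x y : `|dot x y| <= n%:R * (`|x| * `|y|).
Proof.
apply: le_trans (ler_norm_sum _ _ _) _.
rewrite mulr_natl -[X in _ *+ X]card_ord -sumr_const ler_sum // => i _.
by rewrite normrM ler_pM // le_mx_norm.
Qed.

Lemma norm_sqr_le_dot x : `|x| ^+ 2 <= dot x x.
Proof.
have [->|/mx_norm_neq0 [[i j] /= xij]] := eqVneq `|x| 0; first by rewrite expr0n dot_ge0.
rewrite [`|x|]xij ord1 real_normK ?num_real // /dot (bigD1 j) //= -expr2 lerDl.
by apply: sumr_ge0 => k _; rewrite -expr2 sqr_ge0.
Qed.

Lemma enorm_ge0 x : 0 <= enorm x.
Proof. exact: sqrtr_ge0. Qed.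

Lemma enorm_sqr x : enorm x ^+ 2 = dot x x.
Proof.
rewrite /enorm sqr_sqrtr; last by apply: sumr_ge0 => i _; rewrite sqr_ge0.
by apply: eq_bigr => i _; rewrite expr2.
Qed.

Lemma enormE x : enorm x = Num.sqrt (dot x x).
Proof. by rewrite -enorm_sqr sqrtr_sqr ger0_norm // enorm_ge0. Qed.

Lemma enorm0 : enorm (0 : 'rV[R]_n) = 0.
Proof. by rewrite enormE dot0l sqrtr0. Qed.

Lemma enormZ c x : enorm (c *: x) = `|c| * enorm x.
Proof. by rewrite !enormE dotZl dotZr mulrA -expr2 sqrtrM ?sqr_ge0 // sqrtr_sqr. Qed.

Lemma norm_le_enorm x : `|x| <= enorm x.
Proof. by rewrite -(@ler_pXn2r _ 2) ?nnegrE ?enorm_ge0 // enorm_sqr norm_sqr_le_dot. Qed.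

Lemma cauchy_schwarz x y : dot x y <= enorm x * enorm y.
Proof.
have [y0|y0] := eqVneq (dot y y) 0.
  have -> : y = 0.
    apply/eqP; rewrite -normr_eq0 -sqrf_eq0 eq_le sqr_ge0 andbT -y0.
    exact: norm_sqr_le_dot.
  by rewrite dotC dot0l enorm0 mulr0.
have yp : 0 < dot y y by rewrite lt_def y0 dot_ge0.
apply: (le_trans (ler_norm _)).
rewrite -(@ler_pXn2r _ 2) ?nnegrE ?mulr_ge0 ?enorm_ge0 // exprMn !enorm_sqr.
rewrite real_normK ?num_real //.
have := dot_ge0 (dot y y *: x - dot x y *: y).
rewrite dotBl !dotBr !dotZl !dotZr (dotC y x).
set X := dot x x; set Y := dot y y; set Z := dot x y => h.
have : 0 <= Y * (X * Y - Z ^+ 2) by move: h; congr (0 <= _); ring.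
by rewrite pmulr_rge0 // subr_ge0.
Qed.

Lemma enorm_continuous : continuous (@enorm R n).
Proof.
rewrite /enorm; apply: continuous_compose; last exact: sqrt_continuous.
apply: continuous_sum => i x.
have c : continuous (fun x : 'rV[R]_n => x 0 i) by exact: coord_continuous.
exact: (cvgM (c x) (c x)).
Qed.

End DotProduct.

Section BallExcess.
Variables (R : realType) (n : nat) (r : R).
Hypothesis r0 : 0 < r.
Implicit Types p v : 'rV[R]_n.

(** This is [p] minus its projection to the ball of radius [r]. *)
Definition excess p : 'rV[R]_n := (1 - r / Num.max r (enorm p)) *: p.

Let max0 p : 0 < Num.max r (enorm p). Proof. by rewrite lt_max r0. Qed.

Lemma excess_in p : enorm p <= r -> excess p = 0.
Proof.
by move=> /max_idPl pr; rewrite /excess pr divff ?gt_eqF // subrr scale0r.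
Qed.

Lemma enorm_excess p : enorm (excess p) = Num.max r (enorm p) - r.
Proof.
have [pr|rp] := leP (enorm p) r; first by rewrite excess_in // enorm0 subrr.
rewrite /excess (max_idPr (ltW rp)) enormZ ger0_norm.
  by rewrite mulrBl mul1r divfK // gt_eqF // (lt_trans r0).
by rewrite subr_ge0 ler_pdivrMr ?(lt_trans r0) // mul1r ltW.
Qed.

(** The squared distance to the ball is convex, and half its gradient is [excess]. *)
Lemma excess_convex p v :
  enorm (excess p) ^+ 2 + 2 * dot (excess p) v <= enorm (excess (p + v)) ^+ 2.
Proof.
have [pr|rp] := leP (enorm p) r.
  by rewrite excess_in // enorm0 dot0l mulr0 expr0n addr0 sqr_ge0.
rewrite !enorm_excess (max_idPr (ltW rp)) /excess (max_idPr (ltW rp)) dotZl.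
have p0 : 0 < enorm p := lt_trans r0 rp.
have cs := cauchy_schwarz p (p + v).
have -> : dot p v = dot p (p + v) - enorm p ^+ 2 by rewrite dotDr enorm_sqr addrAC subrr add0r.
set x := enorm p in rp p0 cs *; set y := enorm (p + v) in cs *.
have s0 : 0 <= 1 - r / x by rewrite subr_ge0 ler_pdivrMr // mul1r ltW.
have h : (1 - r / x) * (dot p (p + v) - x ^+ 2) <= (x - r) * (y - x).
  apply: (@le_trans _ _ ((1 - r / x) * (x * y - x ^+ 2))).
    by rewrite ler_wpM2l // lerD2r.
  by rewrite le_eqVlt; apply/orP; left; apply/eqP; field; rewrite gt_eqF.
have h2 : (x - r) ^+ 2 + 2 * ((1 - r / x) * (dot p (p + v) - x ^+ 2)) <=
    (x - r) ^+ 2 + 2 * ((x - r) * (y - x)).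
  by rewrite lerD2l ler_wpM2l.
apply: le_trans h2 _.
have [yr|ry] := leP y r.
  have -> : (x - r) ^+ 2 + 2 * ((x - r) * (y - x)) = (x - r) * (2 * y - x - r) by ring.
  rewrite subrr expr0n /= pmulr_rle0 ?subr_gt0 //.
  by clear -yr rp; lra.
rewrite -subr_ge0.
have -> : (y - r) ^+ 2 - ((x - r) ^+ 2 + 2 * ((x - r) * (y - x))) = (y - x) ^+ 2 by ring.
exact: sqr_ge0.
Qed.

(** Bounds on averages of [excess] give bounds on averages of [p], which is how
    almost critical points are shown to be bounded. *)
Lemma sub_excess_le p : `|p - excess p| <= r.
Proof.
rewrite /excess -[X in X - _]scale1r -scalerBl opprB addrC subrK.
rewrite normrZ ger0_norm ?divr_ge0 ?(ltW r0) ?(ltW (max0 p)) //.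
rewrite mulrAC ler_pdivrMr // ler_wpM2l ?(ltW r0) //.
by rewrite le_max norm_le_enorm orbT.
Qed.

Lemma excess_continuous : continuous excess.
Proof.
have mc : continuous (fun p => Num.max r (enorm p)).
  have := max_fun_continuous (f := cst r) (g := @enorm R n).
  by apply; [exact: cst_continuous|exact: enorm_continuous].
have sc : continuous (fun p => 1 - r / Num.max r (enorm p)).
  have c1 (a : R) : continuous (fun _ : 'rV[R]_n => a) by exact: cst_continuous.
  have vc : continuous (fun p => (Num.max r (enorm p))^-1).
    by move=> p; apply: (cvgV _ (mc p)); rewrite gt_eqF.
  by move=> p; exact: (cvgB (c1 1 p) (cvgM (c1 r p) (vc p))).
have ic : continuous (fun p : 'rV[R]_n => p) by move=> p; exact: cvg_id.
by move=> p; exact: (cvgZ (sc p) (ic p)).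
Qed.

End BallExcess.

(** * Almost critical points of a linking functional *)

Section AlmostCritical.
Variables (R : realType) (N n : nat).
Notation mat := 'M[R]_(N, n).

Definition mdot (A B : mat) : R := \sum_k dot (row k A) (row k B).

Definition pdot (x y : mat * mat) : R := mdot x.1 y.1 + mdot x.2 y.2.

Lemma pdotZr c x y : pdot x (c *: y) = c * pdot x y.
Proof.
rewrite /pdot /mdot mulrDr !mulr_sumr.
by congr (_ + _); apply: eq_bigr => k _; rewrite -dotZr linearZ.
Qed.

Lemma norm_row_le (A : mat) k : `|row k A| <= `|A|.
Proof. by apply/mx_norm_leP => // i j; rewrite mxE le_mx_norm. Qed.

Lemma norm_sqr_le_mdot A : `|A| ^+ 2 <= mdot A A.
Proof.
have [->|/mx_norm_neq0 [[k j] /= Akj]] := eqVneq `|A| 0.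
  by rewrite expr0n; apply: sumr_ge0 => k _; exact: dot_ge0.
have -> : `|A| = `|row k A|.
  apply/eqP; rewrite eq_le norm_row_le andbT [leLHS]Akj.
  by apply: le_trans (le_mx_norm _ 0 j); rewrite mxE.
rewrite /mdot (bigD1 k) //=; apply: le_trans (norm_sqr_le_dot _) _.
by rewrite lerDl; apply: sumr_ge0 => l _; exact: dot_ge0.
Qed.

Lemma norm_sqr_le_pdot x : `|x| ^+ 2 <= pdot x x.
Proof.
have m0 A : 0 <= mdot A A by apply: sumr_ge0 => k _; exact: dot_ge0.
rewrite prod_normE /pdot /=; have [_|_] := leP `|x.1| `|x.2|.
  by apply: le_trans (norm_sqr_le_mdot _) _; rewrite lerDr.
by apply: le_trans (norm_sqr_le_mdot _) _; rewrite lerDl.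
Qed.

(** The descent direction [- g / (1 + |g|)] is continuous and bounded by [1]; if
    [|g| >= eta], a short step of length [s] along it lowers [A] by at least
    [s * eta ^ 2 / (2 (1 + eta))], and [no_uniform_descent] applies. *)
Lemma almost_critical (A : mat * mat -> R) (g : mat * mat -> mat * mat) (b c : R) :
  continuous A -> continuous g ->
  (forall eps, 0 < eps -> exists2 delta, 0 < delta & forall x v, `|v| <= delta ->
    A (x + v) <= A x + pdot (g x) v + eps * `|v|) ->
  (forall u, c <= A (u, 0)) -> (forall P, A (0, P) <= b) ->
  (forall a, exists r, forall P, r <= `|P| -> A (0, P) <= a) ->
  forall eta, 0 < eta -> exists x, `|g x| < eta /\ c - eta < A x.
Proof.
move=> Ac gc Aexp Aax Ab Afar eta eta0; apply: contrapT => H.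
have gl x : c - eta < A x -> eta <= `|g x|.
  by move=> xa; rewrite leNgt; apply/negP => gx; apply: H; exists x.
have [r Ar] := Afar (c - eta).
have [delta d0 Ad] := Aexp _ (divr_gt0 eta0 (ltr0n _ 2)).
have G0 x : 0 < 1 + `|g x| by rewrite ltr_pwDl.
pose V x := - (1 + `|g x|)^-1 *: g x.
have Vc : continuous V.
  have nc : continuous (fun x => 1 + `|g x|).
    have c1 : continuous (fun _ : mat * mat => 1 : R) by exact: cst_continuous.
    by move=> x; exact: (cvgD (c1 x) (cvg_norm (gc x))).
  have vc : continuous (fun x => (1 + `|g x|)^-1).
    by move=> x; apply: (cvgV _ (nc x)); rewrite gt_eqF.
  by move=> x; exact: (cvgZ (cvgN (vc x)) (gc x)).
pose kappa := eta ^+ 2 / (2 * (1 + eta)).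
have k0 : 0 < kappa by rewrite divr_gt0 ?exprn_gt0 // mulr_gt0 // ltr_pwDl // ltW.
have ac : c - eta < c by rewrite ltrBlDr ltrDl.
apply: (@no_uniform_descent R mat N n A V (c - eta) b c r delta kappa) => // x s xa /andP[s0 sd].
have nV : `|V x| = `|g x| / (1 + `|g x|).
  by rewrite normrZ normrN ger0_norm ?invr_ge0 ?(ltW (G0 x)) // mulrC.
have V1 : `|V x| <= 1 by rewrite nV ler_pdivrMr // mul1r lerDr.
have sV : `|s *: V x| = s * `|V x| by rewrite normrZ ger0_norm.
apply: le_trans (Ad x (s *: V x) _) _.
  by rewrite sV (le_trans _ sd) // ler_piMr.
rewrite -addrA lerD2l sV pdotZr -mulrN mulrCA -mulrDr ler_wpM2l //.
have -> : pdot (g x) (V x) = - (pdot (g x) (g x) / (1 + `|g x|)).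
  by rewrite /V pdotZr mulNr mulrC.
have gx := gl _ xa; rewrite nV; set G := `|g x| in gx nV *.
have GG := norm_sqr_le_pdot (g x); rewrite -/G in GG.
have G1 : 0 < 1 + G by exact: G0.
apply: (@le_trans _ _ (- (G ^+ 2 / (1 + G)) + eta / 2 * (G / (1 + G)))).
  by rewrite lerD2r lerN2 ler_wpM2r // invr_ge0 ltW.
have -> : - (G ^+ 2 / (1 + G)) + eta / 2 * (G / (1 + G)) = - (G * (G - eta / 2) / (1 + G)).
  by field; rewrite gt_eqF.
have E1 : 0 < 1 + eta by rewrite ltr_pwDl // ltW.
rewrite lerN2 /kappa invfM mulrA ler_pdivlMr //.
rewrite mulrAC ler_pdivrMr //.
have : 0 <= (G - eta) by rewrite subr_ge0.
set D := G - eta => D0.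
have -> : G = eta + D by rewrite /D addrC subrK.
rewrite -subr_ge0.
have -> : (eta + D) * (eta + D - eta / 2) * (1 + eta) - eta ^+ 2 / 2 * (1 + (eta + D)) =
  D * (eta * (3/2) + D) * (1 + eta) + eta ^+ 2 / 2 * (1 + eta) - eta ^+ 2 / 2 * (1 + eta) - eta ^+ 2 / 2 * D by field.
rewrite addrK.
have -> : D * (eta * (3/2) + D) * (1 + eta) - eta ^+ 2 / 2 * D =
 D * (eta * (3/2) + D + eta * eta + eta * D) by field.
have e0 := ltW eta0; apply: mulr_ge0 => //.
by clearbody D; rewrite !addr_ge0 ?mulr_ge0 ?divr_ge0.
Qed.

End AlmostCritical.

(** * Tame Hamiltonians *)

(** The properties of the Hamiltonian and of its partial gradients [Hq], [Hp] that
    the variational argument uses.  They hold for all times: the Hamiltonian is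
    frozen before time [0] and after time [1]. *)
Record tame_hamiltonian (R : realType) (n : nat) (r : R)
    (H : R -> 'rV[R]_n -> 'rV[R]_n -> R)
    (Hq Hp : R -> 'rV[R]_n -> 'rV[R]_n -> 'rV[R]_n) : Prop := {
  tame_radius : 0 < r < 1;
  tame_bounded : exists C, forall t q p,
    [/\ `|H t q p| <= C, `|Hq t q p| <= C & `|Hp t q p| <= C];
  tame_unif : forall eps, 0 < eps -> exists2 delta, 0 < delta &
    forall t t' q q' p p', `|t - t'| <= delta -> `|q - q'| <= delta -> `|p - p'| <= delta ->
    [/\ `|H t q p - H t' q' p'| <= eps, `|Hq t q p - Hq t' q' p'| <= eps &
        `|Hp t q p - Hp t' q' p'| <= eps];
  tame_expand : forall eps, 0 < eps -> exists2 delta, 0 < delta &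
    forall t q p a b, `|a| <= delta -> `|b| <= delta ->
    `|H t (q + a) (p + b) - H t q p - dot (Hq t q p) a - dot (Hp t q p) b|
      <= eps * (`|a| + `|b|);
  tame_periodic : forall t q p (k : 'rV[int]_n),
    [/\ H t (q + vecZ R k) p = H t q p, Hq t (q + vecZ R k) p = Hq t q p &
        Hp t (q + vecZ R k) p = Hp t q p];
  tame_vanish : forall t q p, r < enorm p ->
    [/\ H t q p = 0, Hq t q p = 0 & Hp t q p = 0]
}.

(** * The discrete action functional *)

Lemma tame_continuous (R : realType) n r H Hq Hp (tH : @tame_hamiltonian R n r H Hq Hp) t :
  [/\ continuous (fun z : 'rV[R]_n * 'rV[R]_n => H t z.1 z.2),
      continuous (fun z : 'rV[R]_n * 'rV[R]_n => Hq t z.1 z.2) &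
      continuous (fun z : 'rV[R]_n * 'rV[R]_n => Hp t z.1 z.2)].
Proof.
have K (z : 'rV[R]_n * 'rV[R]_n) (e : R) : 0 < e -> \forall y \near z,
    [/\ `|H t z.1 z.2 - H t y.1 y.2| <= e, `|Hq t z.1 z.2 - Hq t y.1 y.2| <= e
      & `|Hp t z.1 z.2 - Hp t y.1 y.2| <= e].
  move=> e0; have [d d0 Hd] := tame_unif tH e0.
  have : \forall y \near z, `|z - y| <= d by apply: (@cvgr_dist_le _ _ _ (nbhs z) _ id z) => //; exact: cvg_id.
  apply: filterS => y; rewrite prod_normE ge_max => /andP[y1 y2].
  by apply: Hd => //; rewrite subrr normr0 ltW.
by split=> z; apply/cvgrPdist_le => e e0; apply: filterS (K z e e0) => y [].
Qed.

Section DiscreteAction.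
Variables (R : realType) (n N' : nat) (r B C c : R).
Variables (H : R -> 'rV[R]_n -> 'rV[R]_n -> R).
Variables (Hq Hp : R -> 'rV[R]_n -> 'rV[R]_n -> 'rV[R]_n).
Variable e : 'rV[R]_n.
Hypothesis tH : tame_hamiltonian r H Hq Hp.
Hypothesis B0 : 0 < B.
Hypothesis HC : forall t q p, [/\ `|H t q p| <= C, `|Hq t q p| <= C & `|Hp t q p| <= C].
Hypothesis cH : forall t q, 0 <= t <= 1 -> c <= H t q 0.

Notation N := N'.+1.
Notation mat := 'M[R]_(N, n).
Let h : R := N%:R^-1.
Let tm (k : nat) : R := k%:R * h.

Let r0 : 0 < r. Proof. by case/andP: (tame_radius tH). Qed.
Let h0 : 0 < h. Proof. by rewrite invr_gt0 ltr0n. Qed.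
Let h1 : h <= 1. Proof. by rewrite invf_le1 ?ltr0n // ler1n. Qed.
Let hN : N%:R * h = 1. Proof. by rewrite divff // pnatr_eq0. Qed.
Let C0 : 0 <= C. Proof. by case: (HC 0 0 0) => /(le_trans (normr_ge0 _)). Qed.

(** The cyclic variable [u] is the deviation of [q] from the straight loop [t e]. *)
Definition position (u : mat) (k : 'I_N) : 'rV[R]_n := row k u + tm k *: e.

Definition discrete_action (x : mat * mat) : R :=
  \sum_(k < N) (h * (H (tm k) (position x.1 k) (row k x.2)
               - B * enorm (excess r (row k x.2)) ^+ 2 - dot (row k x.2) e)
          - dot (row k x.2) (row (ordS k) x.1 - row k x.1)).

Definition discrete_gradient (x : mat * mat) : mat * mat :=
  (\matrix_(k < N) (h *: Hq (tm k) (position x.1 k) (row k x.2)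
              + (row k x.2 - row (ord_pred k) x.2)),
   \matrix_(k < N) (h *: (Hp (tm k) (position x.1 k) (row k x.2)
                    - (2 * B) *: excess r (row k x.2) - e)
              - (row (ordS k) x.1 - row k x.1))).

Let row_cont k : continuous (row k : mat -> 'rV[R]_n).
Proof.
apply: continuous_mx => i j.
have -> : (fun u : mat => row k u i j) = (fun u => u k j) by apply/funext => u; rewrite mxE.
exact: coord_continuous.
Qed.
Let rowu_cont k : continuous (fun x : mat * mat => row k x.1).
Proof. exact: (continuous_compose (@continuous_fst _ _) (@row_cont k)). Qed.

Let rowP_cont k : continuous (fun x : mat * mat => row k x.2).
Proof. exact: (continuous_compose (@continuous_snd _ _) (@row_cont k)). Qed.

Let cst_cont (T : topologicalType) (a : T) : continuous (fun _ : mat * mat => a).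
Proof. exact: cst_continuous. Qed.

Let phase_cont k : continuous (fun x : mat * mat => (position x.1 k, row k x.2)).
Proof.
apply: continuous_pair; last exact: rowP_cont.
by rewrite /position => x; exact: (cvgD (@rowu_cont k x) (@cst_cont _ (tm k *: e) x)).
Qed.

Let dot_cont (f g : mat * mat -> 'rV[R]_n) :
  continuous f -> continuous g -> continuous (fun x => dot (f x) (g x)).
Proof.
move=> fc gc; apply: continuous_sum => i.
have ic : continuous (fun x : 'rV[R]_n => x 0 i) by exact: coord_continuous.
have cf := continuous_compose fc ic; have cg := continuous_compose gc ic.
by move=> x; exact: (cvgM (cf x) (cg x)).
Qed.

Lemma discrete_action_continuous : continuous discrete_action.
Proof.
apply: continuous_sum => k.
have [Hc _ _] := tame_continuous tH (tm k).
have c1 := continuous_compose (@phase_cont k) Hc.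
have c2 : continuous (fun x : mat * mat => enorm (excess r (row k x.2))).
  apply: continuous_compose (@enorm_continuous R n).
  apply: continuous_compose; [exact: rowP_cont|exact: excess_continuous].
have c3 := dot_cont (@rowP_cont k) (@cst_cont _ e).
have c4 : continuous (fun x : mat * mat => row (ordS k) x.1 - row k x.1).
  by move=> x; exact: (cvgB (@rowu_cont _ x) (@rowu_cont _ x)).
have c5 := dot_cont (@rowP_cont k) c4.
have c6 : continuous (fun x : mat * mat => B * enorm (excess r (row k x.2)) ^+ 2).
  by move=> x; exact: (cvgM (@cst_cont _ _ x) (cvgM (c2 x) (c2 x))).
by move=> x; exact: (cvgB (cvgM (@cst_cont _ _ x) (cvgB (cvgB (c1 x) (c6 x)) (c3 x))) (c5 x)).
Qed.

Let mx_of_rows_cont (f : 'I_N -> mat * mat -> 'rV[R]_n) :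
  (forall k, continuous (f k)) -> continuous (fun x => \matrix_(k < N) f k x).
Proof.
move=> fc; apply: continuous_mx => k j.
have -> : (fun x => (\matrix_(k < N) f k x) k j) = (fun x => f k x 0 j).
  by apply/funext => x; rewrite mxE.
exact: (continuous_compose (fc k) (@coord_continuous _ _ _ 0 j)).
Qed.

Lemma gradient_continuous : continuous discrete_gradient.
Proof.
apply: continuous_pair; apply: mx_of_rows_cont => k.
  have [_ Hc _] := tame_continuous tH (tm k).
  have c1 := continuous_compose (@phase_cont k) Hc.
  move=> x; apply: (cvgD (cvgZ (@cst_cont _ _ x) (c1 x))).
  exact: (cvgB (@rowP_cont _ x) (@rowP_cont _ x)).
have [_ _ Hc] := tame_continuous tH (tm k).
have c1 := continuous_compose (@phase_cont k) Hc.
have c2 : continuous (fun x : mat * mat => excess r (row k x.2)).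
  apply: continuous_compose; [exact: rowP_cont|exact: excess_continuous].
move=> x; apply: cvgB; last exact: (cvgB (@rowu_cont _ x) (@rowu_cont _ x)).
exact: (cvgZ (@cst_cont _ _ x) (cvgB (cvgB (c1 x) (cvgZ (@cst_cont _ _ x) (c2 x))) (@cst_cont _ _ x))).
Qed.

Lemma sum_ordS (V : zmodType) (f : 'I_N -> V) : \sum_k f (ordS k) = \sum_k f k.
Proof. by rewrite [RHS](reindex_inj (@ordS_inj _)). Qed.

Lemma sum_cyclic_diff (V : zmodType) (f : 'I_N -> V) : \sum_k (f (ordS k) - f k) = 0.
Proof. by rewrite sumrB sum_ordS subrr. Qed.

(** Descent uses the expansion of the action from above, and there the convexity of
    the penalty bounds its contribution by the linear term. *)
Lemma action_expand eps : 0 < eps -> exists2 delta, 0 < delta &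
  forall x v, `|v| <= delta ->
    discrete_action (x + v) <= discrete_action x + pdot (discrete_gradient x) v + eps * `|v|.
Proof.
move=> eps0.
have [d1 d10 Hd] := tame_expand tH (divr_gt0 eps0 (ltr0n _ 4)).
have Nn0 : 0 < (4 * (N * n).+1)%:R :> R by rewrite ltr0n.
exists (Num.min d1 (eps / (4 * (N * n).+1)%:R)).
  by rewrite lt_min d10 divr_gt0.
move=> x v; rewrite le_min => /andP[vd1 vd2].
have v1 k : `|row k v.1| <= `|v|.
  by apply: le_trans (norm_row_le _ _) _; rewrite prod_normE le_max lexx.
have v2 k : `|row k v.2| <= `|v|.
  by apply: le_trans (norm_row_le _ _) _; rewrite prod_normE le_max lexx orbT.
pose a k := row k v.1; pose b k := row k v.2; pose p k := row k x.2.
have E : pdot (discrete_gradient x) v = \sum_(k < N) (h * (dot (Hq (tm k) (position x.1 k) (p k)) (a k)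
     + dot (Hp (tm k) (position x.1 k) (p k)) (b k)
     - 2 * B * dot (excess r (p k)) (b k) - dot (b k) e)
     - dot (b k) (row (ordS k) x.1 - row k x.1)
     - dot (p k) (a (ordS k) - a k)).
  have S : \sum_k dot (p k) (a (ordS k)) = \sum_k dot (p (ord_pred k)) (a k).
    rewrite -[RHS]sum_ordS; apply: eq_bigr => k _; by rewrite ordSK.
  rewrite /pdot /mdot.
  under eq_bigr => k _ do rewrite rowK dotDl dotBl -/(a k) -/(p k) -/(p (ord_pred k)) dotZl.
  rewrite big_split sumrB -S /= -sumrB addrC -!big_split /=; apply: eq_bigr => k _.
  rewrite rowK -/(p k) -/(b k) -/(a k) dotBl dotZl !dotBl dotZl (dotC e) !(dotBr (p k)).
  by rewrite (dotBr (b k)) !(dotC _ (b k)); ring.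
apply: (@le_trans _ _ (discrete_action x + pdot (discrete_gradient x) v +
   \sum_(k < N) (h * (eps / 2 * `|v|) + 2 * n%:R * `|v| ^+ 2))); last first.
  rewrite lerD2l; set Z := h * _ + _.
  have -> : \sum_(k < N) Z = N%:R * Z by rewrite sumr_const card_ord mulr_natl.
  rewrite /Z mulrDr mulrA hN mul1r.
  have -> : eps * `|v| = eps / 2 * `|v| + eps / 2 * `|v| by field.
  rewrite lerD2l.
  have -> : N%:R * (2 * n%:R * `|v| ^+ 2) = (2 * (N * n)%:R * `|v|) * `|v| :> R.
    by rewrite natrM; ring.
  rewrite ler_wpM2r //; move: vd2; rewrite ler_pdivlMr // => vd2.
  have : 2 * (2 * (N * n)%:R * `|v|) <= eps.
    apply: le_trans vd2; rewrite (natrM _ 4) -(natr1 (N * n)) -subr_ge0.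
    have -> : `|v| * (4 * ((N * n)%:R + 1)) - 2 * (2 * (N * n)%:R * `|v|) = 4 * `|v| by ring.
    by rewrite mulr_ge0.
  by move=> ?; lra.
rewrite E /discrete_action -!big_split /=; apply: ler_sum => k _.
rewrite !linearD /= -/(a k) -/(b k) -/(p k) -/(a (ordS k)).
have -> : position (x.1 + v.1) k = position x.1 k + a k.
  by rewrite /position linearD /= addrAC.
set q := position x.1 k; set du := row (ordS k) x.1 - row k x.1.
have -> : row (ordS k) x.1 + a (ordS k) + (- row k x.1 - a k) = du + (a (ordS k) - a k).
  by rewrite /du addrACA.
have X1 : H (tm k) (q + a k) (p k + b k) <= H (tm k) q (p k)
    + dot (Hq (tm k) q (p k)) (a k) + dot (Hp (tm k) q (p k)) (b k) + eps / 2 * `|v|.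
  have := Hd (tm k) q (p k) (a k) (b k) (le_trans (v1 k) vd1) (le_trans (v2 k) vd1).
  move=> /(le_trans (ler_norm _)).
  have : eps / 4 * (`|a k| + `|b k|) <= eps / 2 * `|v|.
    have -> : eps / 2 * `|v| = eps / 4 * (`|v| + `|v|) by field.
    by rewrite ler_wpM2l ?divr_ge0 ?(ltW eps0) //; apply: lerD; [exact: v1|exact: v2].
  by move=> ? ?; lra.
have X2 := excess_convex r0 (p k) (b k).
have X3 : - dot (b k) (a (ordS k) - a k) <= 2 * n%:R * `|v| ^+ 2.
  apply: (le_trans (ler_norm _)); rewrite normrN.
  apply: le_trans (dot_le_norm _ _) _.
  have -> : 2 * n%:R * `|v| ^+ 2 = n%:R * (`|v| * (2 * `|v|)) by ring.
  rewrite ler_wpM2l //; apply: ler_pM => //; first exact: v2.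
  apply: (le_trans (ler_normB _ _)).
  by rewrite mulr_natl mulr2n; apply: lerD; exact: v1.
rewrite !dotDr !dotDl.
have X4 : h * (H (tm k) (q + a k) (p k + b k) - B * enorm (excess r (p k + b k)) ^+ 2) <=
   h * (H (tm k) q (p k)
    + dot (Hq (tm k) q (p k)) (a k) + dot (Hp (tm k) q (p k)) (b k) + eps / 2 * `|v|
    - B * (enorm (excess r (p k)) ^+ 2 + 2 * dot (excess r (p k)) (b k))).
  by rewrite ler_wpM2l ?(ltW h0) // lerB // ler_wpM2l // ltW.
rewrite !dotNr; rewrite dotDr dotNr -subr_ge0 in X3; rewrite -subr_ge0 in X4.
rewrite -subr_ge0; apply: le_trans (addr_ge0 X3 X4) _.
by rewrite le_eqVlt; apply/orP; left; apply/eqP; ring.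
Qed.

Let sum_h (a : R) : \sum_(k < N) h * a = a.
Proof. by rewrite sumr_const card_ord -mulr_natl mulrA hN mul1r. Qed.

Lemma action_axis u : c <= discrete_action (u, 0).
Proof.
rewrite /discrete_action /=.
rewrite -[leLHS]sum_h; apply: ler_sum => k _.
have -> : row k 0 = 0 :> 'rV[R]_n by apply/rowP => i; rewrite !mxE.
rewrite !dot0l !subr0 (excess_in r0) ?enorm0 ?(ltW r0) // expr0n mulr0 subr0.
rewrite ler_wpM2l ?(ltW h0) // cH // /tm mulr_ge0 ?(ltW h0) //=.
apply: (@le_trans _ _ (N%:R * h)); last by rewrite hN.
by rewrite ler_wpM2r ?(ltW h0) // ler_nat ltnW.
Qed.

Let E := enorm e.
Let C2 := E * r + (E + 1) ^+ 2 / (4 * B).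

(** The constant [C2] comes from completing the square in the distance from [p] to
    the ball, with [|p| <= r + distance].  The remaining term, minus that distance,
    makes the action small far out on the fibre. *)
Let fiber_term_le t q p :
  H t q p - B * enorm (excess r p) ^+ 2 - dot p e <= C + C2 - (Num.max r (enorm p) - r).
Proof.
have HC1 : H t q p <= C by case: (HC t q p) => /(le_trans (ler_norm _)).
rewrite (enorm_excess r0); set M := Num.max r _.
have pM : enorm p <= M by rewrite le_max lexx orbT.
have pe : - dot p e <= M * E.
  rewrite -dotNl; apply: le_trans (cauchy_schwarz _ _) _.
  by rewrite -scaleN1r enormZ normrN1 mul1r ler_wpM2r // enorm_ge0.
suff : - (B * (M - r) ^+ 2) + M * E <= C2 - (M - r) by move: HC1 pe; lra.
set d := M - r; have -> : M = r + d by rewrite /d addrC subrK.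
rewrite /C2 -subr_ge0.
have -> : E * r + (E + 1) ^+ 2 / (4 * B) - d - (- (B * d ^+ 2) + (r + d) * E) =
   (2 * B * d - (E + 1)) ^+ 2 / (4 * B) by field; rewrite gt_eqF.
by rewrite divr_ge0 ?sqr_ge0 // mulr_ge0 // ltW.
Qed.

Let action_fiber P : discrete_action (0, P) <=
  \sum_(k < N) h * (C + C2 - (Num.max r (enorm (row k P)) - r)).
Proof.
rewrite /discrete_action /=; apply: ler_sum => k _.
by rewrite !linear0 addr0 [dot _ 0]dotC dot0l subr0 ler_wpM2l ?(ltW h0) //.
Qed.

Lemma action_fiber_le P : discrete_action (0, P) <= C + C2.
Proof.
apply: le_trans (action_fiber P) _; rewrite -[leRHS]sum_h; apply: ler_sum => k _.
by rewrite ler_wpM2l ?(ltW h0) // lerBlDr lerDl subr_ge0 le_max lexx.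
Qed.

Lemma action_fiber_far a : exists s, forall P, s <= `|P| -> discrete_action (0, P) <= a.
Proof.
exists (r + N%:R * `|C + C2 - a|) => P sP.
have P0 : `|P| != 0.
  by rewrite gt_eqF // (lt_le_trans _ sP) // ltr_pwDl // mulr_ge0.
have [[k i] /= Pki] := mx_norm_neq0 P0.
apply: le_trans (action_fiber P) _.
have sumB : \sum_(k < N) h * (C + C2 - (Num.max r (enorm (row k P)) - r)) =
  C + C2 - \sum_(k < N) h * (Num.max r (enorm (row k P)) - r).
  by rewrite -[X in X - _]sum_h -sumrB; apply: eq_bigr => l _; rewrite -mulrBr.
rewrite sumB (bigD1 k) //=.
have rest : 0 <= \sum_(l < N | l != k) h * (Num.max r (enorm (row l P)) - r).
  by apply: sumr_ge0 => l _; rewrite mulr_ge0 ?(ltW h0) // subr_ge0 le_max lexx.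
have Pk : `|P| <= Num.max r (enorm (row k P)).
  rewrite le_max; apply/orP; right; rewrite [leLHS]Pki.
  by apply: le_trans (norm_le_enorm _); apply: le_trans (le_mx_norm _ 0 i); rewrite mxE.
have : `|C + C2 - a| <= h * (Num.max r (enorm (row k P)) - r).
  rewrite mulrC ler_pdivlMr ?ltr0n // mulrC.
  by move: sP Pk; lra.
move=> /(le_trans (ler_norm _)).
by move: rest; lra.
Qed.

Lemma cyclic_walk_le (f : 'I_N -> R) D : 0 <= D ->
  (forall k, `|f k - f (ord_pred k)| <= D) -> forall k, `|f k - f 0| <= N%:R * D.
Proof.
move=> D0 fD k.
suff W : forall j (jN : (j < N)%N), `|f (Ordinal jN) - f 0| <= j%:R * D.
  case: k => j jN; apply: le_trans (W j jN) _.
  by rewrite ler_wpM2r // ler_nat ltnW.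
elim=> [|j IH] jN.
  by rewrite (_ : Ordinal jN = 0) ?subrr ?normr0 ?mul0r //; exact: val_inj.
have jN' : (j < N)%N by exact: ltnW.
have pj : ord_pred (Ordinal jN) = Ordinal jN'.
  by apply: val_inj => /=; rewrite modnDr modn_small.
have -> : f (Ordinal jN) - f 0 =
    (f (Ordinal jN) - f (Ordinal jN')) + (f (Ordinal jN') - f 0) by rewrite addrA subrK.
apply: le_trans (ler_normD _ _) _.
rewrite -natr1 mulrDl mul1r addrC; apply: lerD; first exact: IH.
by rewrite -pj; exact: fD.
Qed.

(** The compactness of almost critical points.  The [u]-part of the gradient
    bounds the steps of [p]; summing the [p]-part over the cycle cancels the
    differences of [u], so the average of [excess p], hence that of [p], is bounded;
    then the [p]-part bounds the steps of [u].  Only differences of [u]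
    can be bounded, the action being invariant under translations ([action_shift]). *)
Lemma gradient_bounded : exists K, forall x, `|discrete_gradient x| <= 1 ->
  (forall k i, `|x.2 k i| <= K) /\ (forall k i, `|x.1 k i - x.1 0 i| <= K).
Proof.
pose M0 := N%:R * (C + 1).
pose M1 := (N%:R + C + `|e|) / (2 * B) + r.
pose M2 := M1 + 2 * M0.
pose M3 := N%:R * (1 + (C + 2 * B * (M2 + r) + `|e|)).
have B2 : 0 < 2 * B by rewrite mulr_gt0.
have M00 : 0 <= M0 by rewrite mulr_ge0 // addr_ge0.
have M10 : 0 <= M1 by rewrite addr_ge0 ?divr_ge0 ?addr_ge0 ?(ltW B2) ?(ltW r0).
have M20 : 0 <= M2 by rewrite addr_ge0 // mulr_ge0.
have M2r0 : 0 <= 2 * B * (M2 + r) by rewrite mulr_ge0 ?(ltW B2) // addr_ge0 // ltW.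
have M3'0 : 0 <= 1 + (C + 2 * B * (M2 + r) + `|e|).
  by rewrite addr_ge0 // addr_ge0 // addr_ge0.
have M30 : 0 <= M3 by rewrite mulr_ge0.
exists (M2 + M3) => x; rewrite prod_normE ge_max => /andP[g1 g2].
pose q k := position x.1 k.
have G1 (k : 'I_N) i : `|h * Hq (tm k) (q k) (row k x.2) 0 i + (x.2 k i - x.2 (ord_pred k) i)| <= 1.
  by have := le_trans (le_mx_norm _ k i) g1; rewrite !mxE.
have G2 (k : 'I_N) i : `|h * (Hp (tm k) (q k) (row k x.2) 0 i - 2 * B * excess r (row k x.2) 0 i - e 0 i)
    - (x.1 (ordS k) i - x.1 k i)| <= 1.
  by have := le_trans (le_mx_norm _ k i) g2; rewrite !mxE.
have hq (k : 'I_N) i : `|h * Hq (tm k) (q k) (row k x.2) 0 i| <= C.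
  rewrite normrM (gtr0_norm h0) -[C]mul1r ler_pM ?(ltW h0) //.
  by case: (HC (tm k) (q k) (row k x.2)) => _ /(le_trans (le_mx_norm _ 0 i)).
have hp (k : 'I_N) i : `|Hp (tm k) (q k) (row k x.2) 0 i| <= C.
  by case: (HC (tm k) (q k) (row k x.2)) => _ _ /(le_trans (le_mx_norm _ 0 i)).
have ei i : `|e 0 i| <= `|e| := le_mx_norm _ _ _.
have ex (k : 'I_N) i : `|x.2 k i - excess r (row k x.2) 0 i| <= r.
  have := le_trans (le_mx_norm _ 0 i) (sub_excess_le r0 (row k x.2)).
  by rewrite !mxE.
have walk i k : `|x.2 k i - x.2 0 i| <= M0.
  apply: (cyclic_walk_le (f := fun k => x.2 k i)) => [|l]; first by rewrite addr_ge0.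
  have := G1 l i; have := hq l i; move: (h * _) (_ - _) => y z.
  by rewrite !ler_norml; move=> /andP[? ?] /andP[? ?]; lra.
have avg i : `|\sum_(k < N) h * x.2 k i| <= M1.
  have S : \sum_(k < N) h * (2 * B * excess r (row k x.2) 0 i) =
     \sum_(k < N) h * (Hp (tm k) (q k) (row k x.2) 0 i - e 0 i)
     - \sum_(k < N) (h * (Hp (tm k) (q k) (row k x.2) 0 i - 2 * B * excess r (row k x.2) 0 i - e 0 i)
                 - (x.1 (ordS k) i - x.1 k i)).
    rewrite [X in _ - X]sumrB (sum_cyclic_diff (fun k => x.1 k i)) subr0 -sumrB.
    by apply: eq_bigr => k _; ring.
  have S1 : `|\sum_(k < N) h * (2 * B * excess r (row k x.2) 0 i)| <= C + `|e| + N%:R.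
    rewrite S; apply: le_trans (ler_normB _ _) _; apply: lerD.
      apply: le_trans (ler_norm_sum _ _ _) _; rewrite -[leRHS]sum_h ler_sum // => k _.
      rewrite normrM (gtr0_norm h0) ler_wpM2l ?(ltW h0) //.
      by apply: le_trans (ler_normB _ _) _; apply: lerD; [exact: hp|exact: ei].
    apply: le_trans (ler_norm_sum _ _ _) _.
    rewrite -[N in leRHS]card_ord -sum1_card natr_sum ler_sum // => k _; exact: G2.
  have -> : \sum_(k < N) h * x.2 k i = \sum_(k < N) h * (x.2 k i - excess r (row k x.2) 0 i)
      + (2 * B)^-1 * \sum_(k < N) h * (2 * B * excess r (row k x.2) 0 i).
    rewrite mulr_sumr -big_split /=; apply: eq_bigr => k _.
    by field; rewrite gt_eqF.
  apply: le_trans (ler_normD _ _) _; rewrite /M1 [leRHS]addrC; apply: lerD; last first.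
    rewrite normrM gtr0_norm ?invr_gt0 // mulrC ler_wpM2r ?invr_ge0 ?(ltW B2) //.
    by apply: le_trans S1 _; rewrite addrAC [_ + N%:R]addrC -addrA addrA.
  apply: le_trans (ler_norm_sum _ _ _) _; rewrite -[leRHS]sum_h ler_sum // => k _.
  by rewrite normrM (gtr0_norm h0) ler_wpM2l ?(ltW h0).
have P0 i : `|x.2 0 i| <= M1 + M0.
  have -> : x.2 0 i = \sum_(k < N) h * x.2 k i - \sum_(k < N) h * (x.2 k i - x.2 0 i).
    by rewrite -sumrB -[LHS]sum_h; apply: eq_bigr => k _; ring.
  apply: le_trans (ler_normB _ _) _; apply: lerD => //.
  apply: le_trans (ler_norm_sum _ _ _) _; rewrite -[leRHS]sum_h ler_sum // => k _.
  by rewrite normrM (gtr0_norm h0) ler_wpM2l ?(ltW h0).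
have PM k i : `|x.2 k i| <= M2.
  have -> : x.2 k i = x.2 0 i + (x.2 k i - x.2 0 i) by rewrite addrC subrK.
  apply: le_trans (ler_normD _ _) _.
  by have := P0 i; have := walk i k; rewrite /M2; lra.
split=> k i; first by apply: le_trans (PM k i) _; rewrite lerDl.
apply: (@le_trans _ _ M3); last by rewrite lerDr.
apply: (cyclic_walk_le (f := fun k => x.1 k i)) => // l.
have := G2 (ord_pred l) i; rewrite ord_predK; move: (ord_pred l) => k'.
set a := h * _; set b := x.1 l i - _ => ab.
have aC : `|a| <= C + 2 * B * (M2 + r) + `|e|.
  rewrite /a normrM (gtr0_norm h0); apply: le_trans (ler_piMl (normr_ge0 _) h1) _.
  apply: le_trans (ler_normB _ _) _; apply: lerD; last exact: ei.
  apply: le_trans (ler_normB _ _) _; apply: lerD; first exact: hp.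
  rewrite normrM gtr0_norm // ler_wpM2l ?(ltW B2) //.
  have := ex k' i; have := PM k' i; rewrite !ler_norml.
  by move=> /andP[? ?] /andP[? ?]; apply/andP; split; lra.
have -> : b = a - (a - b) by rewrite opprB addrC subrK.
by apply: le_trans (ler_normB _ _) _; rewrite addrC lerD.
Qed.

Lemma action_shift (x : mat * mat) (z : 'rV[int]_n) :
  let x' := (x.1 + \matrix_(k < N) vecZ R z, x.2) in
  discrete_action x' = discrete_action x /\ discrete_gradient x' = discrete_gradient x.
Proof.
have pos k : position (x.1 + \matrix_(k < N) vecZ R z) k = position x.1 k + vecZ R z.
  by rewrite /position linearD /= rowK addrAC.
have dif k : row (ordS k) (x.1 + \matrix_(k < N) vecZ R z) - row k (x.1 + \matrix_(k < N) vecZ R z)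
    = row (ordS k) x.1 - row k x.1.
  by rewrite !linearD /= !rowK addrACA subrr addr0.
split; rewrite /discrete_action /discrete_gradient /=.
  by apply: eq_bigr => k _; rewrite pos dif; case: (tame_periodic tH (tm k) (position x.1 k) (row k x.2) z) => -> _ _.
congr pair; apply/row_matrixP => k; rewrite !rowK pos ?dif;
by case: (tame_periodic tH (tm k) (position x.1 k) (row k x.2) z) => _ Eq Ep; rewrite ?Eq ?Ep.
Qed.

Lemma critical_point_exists : exists x : mat * mat,
  [/\ discrete_gradient x = 0, c <= discrete_action x & forall i, 0 <= x.1 0 i <= 1].
Proof.
have AC := almost_critical discrete_action_continuous gradient_continuous action_expand
  action_axis action_fiber_le action_fiber_far.
have AC' (j : nat) : exists x : mat * mat, [/\ `|discrete_gradient x| <= j.+1%:R^-1, c - j.+1%:R^-1 <= discrete_action x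
    & forall i, 0 <= x.1 0 i <= 1].
  have [|x [gx Ax]] := AC j.+1%:R^-1; first by rewrite invr_gt0.
  pose z : 'rV[int]_n := \row_i - Num.floor (x.1 0 i).
  exists (x.1 + \matrix_(k < N) vecZ R z, x.2).
  have [-> ->] := action_shift x z; split; [exact: ltW|exact: ltW|] => i.
  rewrite /= !mxE mulrNz subr_ge0 lerBlDr floor_le.
  by rewrite addrC -[1]/(1%:~R) -intrD ltW // floorD1_gt.
have /choice[x xP] := AC'.
have [K KP] := gradient_bounded.
have x1 j : `|discrete_gradient (x j)| <= 1.
  by case: (xP j) => /le_trans + _ _; apply; rewrite invf_le1 ?ltr0n // ler1n.
have [U [UU oU]] := ultra_nat.
have [P Pl] : exists P : mat, (fun j => (x j).2) @ U --> P.
  by apply: (@ultra_cvg_bounded_mx _ _ _ _ _ _ K) => j k i; case: (KP _ (x1 j)).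
have [u ul] : exists u : mat, (fun j => (x j).1) @ U --> u.
  apply: (@ultra_cvg_bounded_mx _ _ _ _ _ _ (K + 1)) => j k i.
  have -> : (x j).1 k i = ((x j).1 k i - (x j).1 0 i) + (x j).1 0 i by rewrite subrK.
  apply: le_trans (ler_normD _ _) _; apply: lerD; first by case: (KP _ (x1 j)).
  by case: (xP j) => _ _ /(_ i) /andP[a b]; rewrite ger0_norm.
have xl : x @ U --> (u, P).
  have -> : x = (fun j => ((x j).1, (x j).2)) by apply/funext => j; case: (x j).
  exact: (cvg_pair ul Pl).
have invU : (j.+1%:R^-1 : R) @[j --> U] --> (0 : R).
  exact: (ultra_cvg oU (@cvg_harmonic R)).
exists (u, P); split => /=.
- apply/eqP; rewrite -normr_eq0 eq_le normr_ge0 andbT.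
  have gl : `|discrete_gradient (x j)| @[j --> U] --> `|discrete_gradient (u, P)|.
    by have gc := gradient_continuous; exact: (cvg_norm (cvg_comp _ _ xl (gc (u, P)))).
  apply: (ler_cvg_to gl invU); apply: filterE => j.
  by case: (xP j).
- have al : discrete_action (x j) @[j --> U] --> discrete_action (u, P).
    by have ac := discrete_action_continuous; exact: (cvg_comp _ _ xl (ac (u, P))).
  have cl : c - j.+1%:R^-1 @[j --> U] --> c - 0 by apply: cvgB => //; exact: cvg_cst.
  rewrite subr0 in cl; apply: (ler_cvg_to cl al); apply: filterE => j.
  by case: (xP j).
- move=> i; have il : (x j).1 0 i @[j --> U] --> u 0 i by exact: cvg_mxE.
  apply/andP; split.
    by apply: (cvgr_to_ge il); apply: filterE => j; case: (xP j) => _ _ /(_ i) /andP[].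
  by apply: (cvgr_to_le il); apply: filterE => j; case: (xP j) => _ _ /(_ i) /andP[].
Qed.

Lemma cyclic_ind (S : pred 'I_N) : (forall k, S k -> S (ord_pred k)) ->
  forall k0, S k0 -> forall k, S k.
Proof.
move=> Sp k0 Sk0.
have down j : forall k k' : 'I_N, S k -> k = (k' + j)%N :> nat -> S k'.
  elim: j => [|j IH] k k' Sk kk'.
    by rewrite (_ : k' = k) //; apply: val_inj; rewrite /= kk' addn0.
  apply: IH (Sp _ Sk) _; rewrite /= kk'.
  have -> : (k' + j.+1 + N).-1 = (k' + j + N)%N by lia.
  by rewrite modnDr modn_small // (leq_trans _ (ltn_ord k)) // kk' addnS.
have S0 : S 0 by apply: (down k0 k0) => //=.
move=> k; apply: (down (N' - k)%N _ k (Sp _ S0)).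
by rewrite /= modn_small // subnKC // -ltnS.
Qed.

Hypothesis ec : enorm e <= c.
Hypothesis Blarge : enorm e / (4 * B) < 1 - r.

Lemma critical_step x (k : 'I_N) : discrete_gradient x = 0 ->
  row k x.2 - row (ord_pred k) x.2 = - h *: Hq (tm k) (position x.1 k) (row k x.2) /\
  row (ordS k) x.1 - row k x.1 = h *: (Hp (tm k) (position x.1 k) (row k x.2)
     - (2 * B) *: excess r (row k x.2) - e).
Proof.
move=> [/row_matrixP/(_ k) g1 /row_matrixP/(_ k) g2].
move: g1 g2; rewrite !rowK !linear0 => /eqP g1 /eqP g2.
rewrite addrC addr_eq0 in g1; rewrite subr_eq0 in g2.
by rewrite scaleNr -(eqP g1) (eqP g2).
Qed.

(** If [|p_k| > r] for one [k], the step equation for [p] shows that [p] is constant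
    along the cycle.  The steps of [u] are then all equal, so they vanish, and
    [e = - 2 B excess p].  The action is [B (|p| - r) (|p| + r)], while
    [|e| = 2 B (|p| - r)]; so the action is at least [|e|] only if
    [|p| + r >= 2], and [Blarge] excludes this. *)
Lemma critical_radius x : discrete_gradient x = 0 -> c <= discrete_action x ->
  forall k, enorm (row k x.2) <= r.
Proof.
move=> gx cA k0; rewrite leNgt; apply/negP => rk0.
set p := row k0 x.2 in rk0.
have pk : forall k, row k x.2 == p.
  apply: (@cyclic_ind _ _ k0) => [k /eqP rk|]; last by rewrite /p.
  have [+ _] := critical_step k gx; rewrite rk.
  have [_ -> _] := tame_vanish tH (tm k) (position x.1 k) rk0.
  by rewrite scaler0 => /eqP; rewrite subr_eq0 eq_sym.
have {}pk k : row k x.2 = p by apply/eqP.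
have du k : row (ordS k) x.1 - row k x.1 = h *: (- (2 * B) *: excess r p - e).
  have [_ ->] := critical_step k gx; rewrite pk.
  have [_ _ ->] := tame_vanish tH (tm k) (position x.1 k) rk0.
  by rewrite sub0r scaleNr.
have eE : e = - (2 * B) *: excess r p.
  have := sum_cyclic_diff (fun k => row k x.1).
  under eq_bigr => k _ do rewrite du.
  rewrite sumr_const card_ord -scaler_nat scalerA hN scale1r => /eqP.
  by rewrite subr_eq0 => /eqP.
have du0 k : row (ordS k) x.1 - row k x.1 = 0 by rewrite du -eE subrr scaler0.
have AE : discrete_action x = - (B * enorm (excess r p) ^+ 2) - dot p e.
  rewrite -[RHS]sum_h; apply: eq_bigr => k _; rewrite du0 pk [dot _ 0]dotC dot0l subr0.
  by have [-> _ _] := tame_vanish tH (tm k) (position x.1 k) rk0; rewrite sub0r.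
have rho : Num.max r (enorm p) = enorm p by apply/max_idPr; exact: ltW.
have p0 : 0 < enorm p := lt_trans r0 rk0.
have pe : dot p e = - (2 * B * (enorm p * (enorm p - r))).
  rewrite eE dotZr /excess dotZr rho -enorm_sqr mulNr; congr (- (_ * _)).
  by field; rewrite gt_eqF.
have E1 : enorm e = 2 * B * (enorm p - r).
  rewrite eE enormZ normrN gtr0_norm ?mulr_gt0 // (enorm_excess r0) rho //.
have cA' := le_trans ec cA.
move: cA' Blarge; rewrite AE pe E1 (enorm_excess r0) rho => cA'.
rewrite ltr_pdivrMr ?mulr_gt0 // -subr_gt0.
have -> : (1 - r) * (4 * B) - 2 * B * (enorm p - r) = B * (4 * (1 - r) - 2 * (enorm p - r)) by ring.
rewrite pmulr_rgt0 // => small.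
move: cA'; rewrite -subr_ge0.
have -> : - (B * (enorm p - r) ^+ 2) - - (2 * B * (enorm p * (enorm p - r)))
   - 2 * B * (enorm p - r) = B * (enorm p - r) * (enorm p + r - 2) by ring.
by rewrite pmulr_rge0 ?mulr_gt0 ?subr_gt0 //; move: small; lra.
Qed.

(** The momentum is shifted by one step, [p k.+1] being row [k] of the critical point.
    The equation at index [0], which couples the first and the last row, then becomes
    an ordinary step from [p 0] to [p 1], and [p N = p 0] holds by definition. *)
Lemma discrete_orbit_exists : exists q p : nat -> 'rV[R]_n,
  [/\ (forall i, 0 <= q 0%N 0 i <= 1) /\ (forall k, enorm (p k) <= r),
      q N = q 0%N + e /\ p N = p 0%N,
      forall k, (k < N)%N ->
        q k.+1 = q k + h *: Hp (k%:R * h) (q k) (p k.+1) /\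
        p k.+1 = p k - h *: Hq (k%:R * h) (q k) (p k.+1) &
      c <= \sum_(k < N) h * (H (k%:R * h) (q k) (p k.+1)
        - dot (p k.+1) (Hp (k%:R * h) (q k) (p k.+1)))].
Proof.
have [x [gx cx x01]] := critical_point_exists.
have xr := critical_radius gx cx.
pose q k : 'rV[R]_n := row (inord (k %% N)) x.1 + (k%:R * h) *: e.
pose p k : 'rV[R]_n := row (inord ((k + N') %% N)) x.2.
have qE (k : 'I_N) : q k = position x.1 k.
  by rewrite /q /position modn_small // inord_val.
have qS (k : 'I_N) : q k.+1 = row (ordS k) x.1 + (k.+1%:R * h) *: e.
  by congr (row _ _ + _); apply: val_inj; rewrite /= inordK // ltn_pmod.
have pS (k : 'I_N) : p k.+1 = row k x.2.
  by congr (row _ _); apply: val_inj; rewrite /= inordK ?ltn_pmod // addSnnS modnDr modn_small.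
have pE (k : 'I_N) : p k = row (ord_pred k) x.2.
  by congr (row _ _); apply: val_inj; rewrite /= inordK ?ltn_pmod // addnS.
have st (k : 'I_N) : q k.+1 = q k + h *: Hp (tm k) (q k) (p k.+1) /\
        p k.+1 = p k - h *: Hq (tm k) (q k) (p k.+1).
  have [s1 s2] := critical_step k gx.
  rewrite pS pE qE qS; split.
    have := s2; rewrite (excess_in r0) // scaler0 subr0 scalerBr => /eqP.
    rewrite subr_eq => /eqP ->; rewrite /position -natr1 mulrDl mul1r.
    by apply/rowP => i; rewrite !mxE -/(tm k); ring.
  by move: s1; rewrite scaleNr => <-; rewrite addrC subrK.
exists q, p; split.
- split=> [i|k]; last exact: xr.
  rewrite /q mod0n mul0r scale0r addr0 mxE (_ : inord 0 = 0) //.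
  by apply: val_inj; rewrite /= inordK.
- split; last by rewrite /p modnDl.
  by rewrite /q modnn mod0n hN scale1r mul0r scale0r addr0.
- by move=> k kN; exact: (st (Ordinal kN)).
- apply: (le_trans cx); rewrite le_eqVlt; apply/orP; left; apply/eqP.
  have Sd : \sum_(k < N) dot (row k x.2) (row (ordS k) x.1 - row k x.1) =
    \sum_(k < N) (h * (dot (p k.+1) (Hp (tm k) (q k) (p k.+1))) - h * dot (row k x.2) e).
    apply: eq_bigr => k _; have [_ ->] := critical_step k gx.
    by rewrite (excess_in r0) // scaler0 subr0 dotZr dotBr mulrBr pS qE.
  rewrite /discrete_action sumrB Sd -sumrB; apply: eq_bigr => k _.
  rewrite (excess_in r0) // enorm0 expr0n mulr0 subr0 pS qE /tm.
  rewrite -/(tm k); ring.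
Qed.

End DiscreteAction.

Theorem discrete_orbit (R : realType) (n N : nat) (r c : R)
    (H : R -> 'rV[R]_n -> 'rV[R]_n -> R) (Hq Hp : R -> 'rV[R]_n -> 'rV[R]_n -> 'rV[R]_n)
    (e : 'rV[R]_n) :
  tame_hamiltonian r H Hq Hp -> (0 < N)%N ->
  (forall t q, 0 <= t <= 1 -> c <= H t q 0) -> enorm e <= c ->
  exists q p : nat -> 'rV[R]_n,
  [/\ (forall i, 0 <= q 0%N 0 i <= 1) /\ (forall k, enorm (p k) <= r),
      q N = q 0%N + e /\ p N = p 0%N,
      forall k, (k < N)%N ->
        q k.+1 = q k + N%:R^-1 *: Hp (k%:R / N%:R) (q k) (p k.+1) /\
        p k.+1 = p k - N%:R^-1 *: Hq (k%:R / N%:R) (q k) (p k.+1) &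
      c <= \sum_(k < N) N%:R^-1 * (H (k%:R / N%:R) (q k) (p k.+1)
        - dot (p k.+1) (Hp (k%:R / N%:R) (q k) (p k.+1)))].
Proof.
case: N => // N' tH _ cH ec.
have [C HC] := tame_bounded tH.
have /andP[r0 r1] := tame_radius tH.
(* with this B, |e| / (4 B) = (1 - r) |e| / (|e| + 1) < 1 - r *)
have B0 : 0 < (enorm e + 1) / (4 * (1 - r)).
  by rewrite divr_gt0 ?ltr_pwDr ?enorm_ge0 // mulr_gt0 // subr_gt0.
apply: (discrete_orbit_exists N' tH B0 HC cH ec).
have e1 : 0 < enorm e + 1 by rewrite ltr_pwDr ?enorm_ge0.
have -> : enorm e / (4 * ((enorm e + 1) / (4 * (1 - r)))) = enorm e * (1 - r) / (enorm e + 1).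
  by field; rewrite !gt_eqF ?subr_gt0.
by rewrite ltr_pdivrMr // mulrC ltr_pM2l ?subr_gt0 // ltrDl.
Qed.

(** * From discrete orbits to a solution *)

Section EulerSample.
Variables (R : realType) (V : normedModType R) (N : nat).
Hypothesis N0 : (0 < N)%N.
Variables (y phi : nat -> V).
Hypothesis step : forall k, (k < N)%N -> y k.+1 = y k + N%:R^-1 *: phi k.

Definition sample (t : R) : V := y (Num.truncn (t * N%:R)).

Let Nr0 : 0 < N%:R :> R. Proof. by rewrite ltr0n. Qed.

Lemma euler_walk a w m d : (m + d <= N)%N ->
  (forall k, (m <= k < m + d)%N -> `|phi k - a| <= w) ->
  `|y (m + d)%N - y m - (d%:R / N%:R) *: a| <= d%:R / N%:R * w.
Proof.
elim: d => [|d IH] mN pw.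
  by rewrite addn0 subrr mul0r scale0r subr0 normr0 mul0r.
have mN' : (m + d < N)%N by rewrite -addnS.
rewrite addnS step //.
have -> : y (m + d)%N + N%:R^-1 *: phi (m + d)%N - y m - (d.+1%:R / N%:R) *: a =
    (y (m + d)%N - y m - (d%:R / N%:R) *: a) + N%:R^-1 *: (phi (m + d)%N - a).
  rewrite -natr1 mulrDl mul1r scalerDl scalerBr.
  by rewrite (addrAC (y (m + d)%N)) opprD addrACA.
apply: le_trans (ler_normD _ _) _.
rewrite -[in leRHS]natr1 !mulrDl mul1r; apply: lerD.
  by apply: IH => [|k hk]; [exact: ltnW|apply: pw; lia].
rewrite normrZ gtr0_norm ?invr_gt0 // ler_wpM2l ?invr_ge0 //.
by apply: pw; rewrite leq_addr addnS ltnSn.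
Qed.

Lemma truncn01_le (t : R) : 0 <= t <= 1 -> (Num.truncn (t * N%:R) <= N)%N.
Proof.
move=> /andP[t0 t1]; rewrite truncn_le_nat.
by rewrite (@le_lt_trans _ _ (N%:R)) ?ltr_nat // ler_piMl.
Qed.

Lemma truncn_bounds (t : R) : 0 <= t <= 1 ->
  (Num.truncn (t * N%:R))%:R <= t * N%:R < (Num.truncn (t * N%:R))%:R + 1.
Proof.
by move=> /andP[t0 t1]; rewrite natr1 truncn_itv // mulr_ge0 // ltW.
Qed.

Lemma sample_increment (t s : R) a w : 0 <= t <= 1 -> 0 <= s <= 1 -> 0 <= w ->
  (forall k, (k < N)%N ->
     `|k%:R - (Num.truncn (t * N%:R))%:R| <= `|s - t| * N%:R + 1 :> R -> `|phi k - a| <= w) ->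
  `|sample s - sample t - (s - t) *: a| <= (`|s - t| + N%:R^-1) * w + N%:R^-1 * `|a|.
Proof.
move=> t01 s01 w0 near_a; rewrite /sample.
have /andP[m1 m2] := truncn_bounds t01; have /andP[l1 l2] := truncn_bounds s01.
have mN := truncn01_le t01; have lN := truncn01_le s01.
move: near_a m1 m2 l1 l2 mN lN; set m := Num.truncn _; set l := Num.truncn _.
move=> near_a m1 m2 l1 l2 mN lN.
have sub_le (i j d : nat) : j = (i + d)%N -> (j%:R - i%:R : R) = d%:R.
  by move=> ->; rewrite natrD addrC addKr.
have lm : `|(l%:R - m%:R) / N%:R - (s - t)| <= N%:R^-1.
  rewrite -[leRHS]mul1r ler_pdivlMr // -[X in _ * X]gtr0_norm // -normrM.
  rewrite mulrBl divfK ?gt_eqF // ler_norml; apply/andP; split; lra.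
have lm2 : `|(l%:R - m%:R) / N%:R| <= `|s - t| + N%:R^-1.
  have -> : (l%:R - m%:R) / N%:R = (s - t) + ((l%:R - m%:R) / N%:R - (s - t)).
    by rewrite [RHS]addrC subrK.
  by apply: le_trans (ler_normD _ _) _; rewrite lerD2l.
suff W : `|y l - y m - ((l%:R - m%:R) / N%:R) *: a| <= `|(l%:R - m%:R) / N%:R| * w.
  have -> : y l - y m - (s - t) *: a = (y l - y m - ((l%:R - m%:R) / N%:R) *: a)
     + ((l%:R - m%:R) / N%:R - (s - t)) *: a by rewrite [(_ / _ - _) *: a]scalerBl addrA subrK.
  apply: le_trans (ler_normD _ _) _; apply: lerD.
    by apply: le_trans W _; rewrite ler_wpM2r.
  by rewrite normrZ ler_wpM2r.
have st : `|s - t| * N%:R = `|s * N%:R - t * N%:R| by rewrite -mulrBl normrM (gtr0_norm Nr0).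
have [ml|lm'] := leqP m l.
  have E : l = (m + (l - m))%N by rewrite subnKC.
  rewrite (sub_le m l (l - m)%N E) ger0_norm ?divr_ge0 // [in y l]E.
  apply: euler_walk; first by rewrite -E.
  move=> k /andP[mk kl]; apply: near_a; first by rewrite (leq_trans kl) // -E.
  have k1 : m%:R <= k%:R :> R by rewrite ler_nat.
  have k2 : k%:R + 1 <= l%:R :> R by rewrite natr1 ler_nat E.
  rewrite st ger0_norm ?subr_ge0 //.
  by have := ler_norm (s * N%:R - t * N%:R); lra.
have E : m = (l + (m - l))%N by rewrite subnKC // ltnW.
have F : (l%:R - m%:R) / N%:R = - ((m - l)%:R / N%:R) :> R.
  by rewrite -(sub_le l m _ E); ring.
rewrite F scaleNr opprK normrN ger0_norm ?divr_ge0 //.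
have -> : y l - y m + ((m - l)%:R / N%:R) *: a = - (y m - y l - ((m - l)%:R / N%:R) *: a).
  by rewrite !opprD !opprK (addrC (- y m)).
rewrite normrN [in y m]E; apply: euler_walk; first by rewrite -E.
move=> k /andP[lk km]; apply: near_a; first by rewrite (leq_trans km) // -E.
have k1 : l%:R <= k%:R :> R by rewrite ler_nat.
have k2 : k%:R + 1 <= m%:R :> R by rewrite natr1 ler_nat E.
rewrite st distrC ger0_norm; last by rewrite subr_ge0; lra.
by have := ler_norm (t * N%:R - s * N%:R); rewrite distrC; lra.
Qed.

Lemma euler_lipschitz C k l : (forall j, (j < N)%N -> `|phi j| <= C) ->
  (k <= N)%N -> (l <= N)%N -> `|y k - y l| <= `|k%:R - l%:R| / N%:R * C.
Proof.
move=> pC; wlog kl : k l / (l <= k)%N.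
  move=> W kN lN; have [?|/ltnW ?] := leqP l k; first exact: W.
  by rewrite distrC [X in X / _]distrC; exact: W.
move=> kN lN; have E : k = (l + (k - l))%N by rewrite subnKC.
have := @euler_walk 0 C l (k - l)%N.
rewrite -E scaler0 subr0 => /(_ kN) W; rewrite -natrB // normr_nat.
by apply: W => j /andP[_ jk]; rewrite subr0; apply: pC; exact: leq_trans jk kN.
Qed.

End EulerSample.

Section LimitVelocity.
Variables (R : realType) (V : normedModType R).

(** The derivative relative to the unit interval, in the additive form in which it is
    preserved by pointwise limits. *)
Definition has_velocity01 (x : R -> V) (t : R) (a : V) := forall eps, 0 < eps ->
  exists2 delta, 0 < delta & forall s, 0 <= s <= 1 -> `|s - t| <= delta ->
    `|x s - x t - (s - t) *: a| <= eps * `|s - t|.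

Variables (U : set_system nat) (UU : UltraFilter U) (oU : \oo `<=` U).
Variables (y phi : nat -> nat -> V) (a : nat -> V) (t C : R) (Y : R -> V) (b : V).
Hypothesis t01 : 0 <= t <= 1.
Hypothesis step : forall j k, (k < j.+1)%N -> y j k.+1 = y j k + j.+1%:R^-1 *: phi j k.
Hypothesis aC : forall j, `|a j| <= C.
Hypothesis near_a : forall eps, 0 < eps -> exists2 delta : R, 0 < delta & forall j k,
  (k < j.+1)%N -> j.+1%:R^-1 <= delta ->
  `|k%:R - (Num.truncn (t * j.+1%:R))%:R| / j.+1%:R <= delta -> `|phi j k - a j| <= eps.
Hypothesis yY : forall s, 0 <= s <= 1 -> sample j.+1 (y j) s @[j --> U] --> Y s.
Hypothesis ab : a @ U --> b.

(** The increment estimate of [sample_increment] is uniform in the number of steps and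
    concerns two times [s] and [t] only, so it passes to the pointwise limit, where
    the terms in [1/N] disappear. *)
Lemma limit_velocity : has_velocity01 Y t b.
Proof.
move=> eps eps0; have [d d0 Hd] := near_a eps0.
exists (d / 2); first by rewrite divr_gt0.
move=> s s01 sd.
have inv0 : (j.+1%:R^-1 : R) @[j --> U] --> (0 : R).
  exact: (ultra_cvg oU (@cvg_harmonic R)).
have L : `|sample j.+1 (y j) s - sample j.+1 (y j) t - (s - t) *: a j| @[j --> U] -->
    `|Y s - Y t - (s - t) *: b|.
  exact: (cvg_norm (cvgB (cvgB (yY s01) (yY t01)) (cvgZ (cvg_cst (s - t)) ab))).
have M : (`|s - t| + j.+1%:R^-1) * eps + j.+1%:R^-1 * C @[j --> U] -->
    (`|s - t| + 0) * eps + 0 * C.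
  exact: (cvgD (cvgM (cvgD (cvg_cst `|s - t|) inv0) (cvg_cst eps)) (cvgM inv0 (cvg_cst C))).
rewrite addr0 mul0r addr0 mulrC in M.
apply: (ler_cvg_to L M).
have : \forall j \near U, (j.+1%:R^-1 : R) <= d / 2.
  by have := cvgr_le 0 inv0; apply; rewrite divr_gt0.
apply: filterS => j jd.
have j0 : 0 < j.+1%:R :> R by rewrite ltr0n.
apply: (@le_trans _ _ ((`|s - t| + j.+1%:R^-1) * eps + j.+1%:R^-1 * `|a j|)); last first.
  by rewrite lerD2l ler_wpM2l ?invr_ge0.
apply: (sample_increment (ltn0Sn j) (phi := phi j)) => //; [exact: step|exact: ltW|].
move=> k kj km; apply: Hd => //; first by apply: le_trans jd _; lra.
rewrite ler_pdivrMr //; apply: le_trans km _.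
rewrite -ler_pdivrMr // mulrDl mulfK ?gt_eqF // mul1r.
by rewrite [leRHS]splitr; exact: lerD.
Qed.

End LimitVelocity.

Section LimitOrbit.
Variables (R : realType) (n : nat) (r c C : R).
Variables (H : R -> 'rV[R]_n -> 'rV[R]_n -> R).
Variables (Hq Hp : R -> 'rV[R]_n -> 'rV[R]_n -> 'rV[R]_n).
Variable e : 'rV[R]_n.
Hypothesis tH : tame_hamiltonian r H Hq Hp.
Hypothesis HC : forall t q p, [/\ `|H t q p| <= C, `|Hq t q p| <= C & `|Hp t q p| <= C].

(** Along a solution [q' = H_p], so this is the integrand [H - p.q'] of the action. *)
Definition lagrangian t q p : R := H t q p - dot p (Hp t q p).

Variables q p : nat -> nat -> 'rV[R]_n.
Hypothesis q01 : forall j i, 0 <= q j 0%N 0 i <= 1.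
Hypothesis pr : forall j k, enorm (p j k) <= r.
Hypothesis q_end : forall j, q j j.+1 = q j 0%N + e.
Hypothesis p_end : forall j, p j j.+1 = p j 0%N.
Hypothesis q_step : forall j k, (k < j.+1)%N ->
  q j k.+1 = q j k + j.+1%:R^-1 *: Hp (k%:R / j.+1%:R) (q j k) (p j k.+1).
Hypothesis p_step : forall j k, (k < j.+1)%N ->
  p j k.+1 = p j k + j.+1%:R^-1 *: - Hq (k%:R / j.+1%:R) (q j k) (p j k.+1).
Hypothesis q_action : forall j, c <= \sum_(k < j.+1)
  j.+1%:R^-1 * lagrangian (k%:R / j.+1%:R) (q j k) (p j k.+1).

Variables (U : set_system nat) (UU : UltraFilter U) (oU : \oo `<=` U).

Let C0 : 0 <= C. Proof. by case: (HC 0 0 0) => /(le_trans (normr_ge0 _)). Qed.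

Let q_lip j k l : (k <= j.+1)%N -> (l <= j.+1)%N ->
  `|q j k - q j l| <= `|k%:R - l%:R| / j.+1%:R * C.
Proof.
apply: (euler_lipschitz (ltn0Sn j) (phi := fun k => Hp (k%:R / j.+1%:R) (q j k) (p j k.+1))).
  exact: q_step.
by move=> i _; case: (HC (i%:R / j.+1%:R) (q j i) (p j i.+1)).
Qed.

Let p_lip j k l : (k <= j.+1)%N -> (l <= j.+1)%N ->
  `|p j k - p j l| <= `|k%:R - l%:R| / j.+1%:R * C.
Proof.
apply: (euler_lipschitz (ltn0Sn j) (phi := fun k => - Hq (k%:R / j.+1%:R) (q j k) (p j k.+1))).
  exact: p_step.
by move=> i _; rewrite normrN; case: (HC (i%:R / j.+1%:R) (q j i) (p j i.+1)).
Qed.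

(** Any quantity that grows along the discrete orbits with rate [F] has a limit with
    velocity [F] along the limit orbit: the positions, the momenta and the partial
    sums of the action are treated alike. *)
Lemma orbit_component (V : normedModType R) (F : R -> 'rV[R]_n -> 'rV[R]_n -> V)
    (y : nat -> nat -> V) (Y : R -> V) (Q P : R -> 'rV[R]_n) (CF t : R) :
  (forall t q p, enorm p <= r -> `|F t q p| <= CF) ->
  (forall eps, 0 < eps -> exists2 delta, 0 < delta & forall t t' q q' p p',
     `|t - t'| <= delta -> `|q - q'| <= delta -> `|p - p'| <= delta ->
     enorm p <= r -> enorm p' <= r -> `|F t q p - F t' q' p'| <= eps) ->
  (forall j k, (k < j.+1)%N -> y j k.+1 = y j k + j.+1%:R^-1 *: F (k%:R / j.+1%:R) (q j k) (p j k.+1)) ->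
  (forall s, 0 <= s <= 1 -> [/\ sample j.+1 (q j) s @[j --> U] --> Q s,
     sample j.+1 (p j) s @[j --> U] --> P s & sample j.+1 (y j) s @[j --> U] --> Y s]) ->
  0 <= t <= 1 -> enorm (P t) <= r ->
  has_velocity01 Y t (F t (Q t) (P t)).
Proof.
move=> FC Fu ys lims t01 Pr.
pose a j := F t (sample j.+1 (q j) t) (sample j.+1 (p j) t).
have ab : a @ U --> F t (Q t) (P t).
  apply/cvgrPdist_le => eps eps0; have [d d0 Hd] := Fu _ eps0.
  have [/cvgrPdist_le Ql /cvgrPdist_le Pl _] := lims t t01.
  apply: (@filterS2 nat U _ _ _ _ _ (Ql d d0) (Pl d d0)) => j qd pd; apply: Hd => //; last exact: pr.
  by rewrite subrr normr0 ltW.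
apply: (limit_velocity UU oU (y := y) (a := a) (C := CF) t01 ys) => //.
- by move=> j; apply: FC; exact: pr.
- move=> eps eps0; have [d d0 Hd] := Fu _ eps0.
  have C1 : 0 < 2 * (C + 1) by rewrite mulr_gt0 // ltr_pwDr.
  (* positions and momenta move with speed at most C, the sampled index lags behind
     the time by up to one step, and the momentum is taken one index ahead *)
  exists (d / (2 * (C + 1))); first by rewrite divr_gt0.
  set m := d / _ => j k kj jm km.
  have md : 2 * (C + 1) * m = d by rewrite mulrC divfK // gt_eqF.
  have m0 : 0 < m by rewrite divr_gt0.
  have j0 : 0 < j.+1%:R :> R by rewrite ltr0n.
  have tN := truncn01_le j.+1 t01.
  have /andP[t1 t2] := truncn_bounds j.+1 t01.
  rewrite /a /sample; move: km tN t1 t2; set l := Num.truncn _ => km tN t1 t2.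
  apply: Hd; [| | |exact: pr|exact: pr].
  + have -> : k%:R / j.+1%:R - t = (k%:R - l%:R) / j.+1%:R + (l%:R - t * j.+1%:R) / j.+1%:R :> R.
      by field; rewrite gt_eqF.
    apply: le_trans (ler_normD _ _) _.
    have -> : `|(k%:R - l%:R) / j.+1%:R| = `|k%:R - l%:R| / j.+1%:R :> R.
      by rewrite normrM [`|_^-1|]gtr0_norm ?invr_gt0.
    have : `|(l%:R - t * j.+1%:R) / j.+1%:R| <= m.
      rewrite normrM [`|_^-1|]gtr0_norm ?invr_gt0 // (le_trans _ jm) //.
      by rewrite ler_piMl ?invr_ge0 ?(ltW j0) // ler_norml; apply/andP; split; lra.
    move=> hb; apply: (@le_trans _ _ (m + m)); first exact: lerD.
    rewrite -md -subr_ge0; have -> : 2 * (C + 1) * m - (m + m) = 2 * (C * m) by ring.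
    by rewrite mulr_ge0 // mulr_ge0 // ltW.
  + apply: le_trans (q_lip (ltnW kj) tN) _.
    apply: (@le_trans _ _ (m * C)); first by rewrite ler_wpM2r.
    rewrite -md -subr_ge0; have -> : 2 * (C + 1) * m - m * C = C * m + 2 * m by ring.
    by rewrite addr_ge0 // mulr_ge0 // ltW.
  + apply: le_trans (p_lip kj tN) _.
    have k1 : `|k.+1%:R - l%:R| <= `|k%:R - l%:R| + 1 :> R.
      by rewrite -natr1 addrAC; apply: le_trans (ler_normD _ _) _; rewrite normr1.
    apply: (@le_trans _ _ ((m + m) * C)).
      rewrite ler_wpM2r // ler_pdivrMr //; apply: (le_trans k1).
      rewrite mulrDl; apply: lerD; first by rewrite -ler_pdivrMr.
      by rewrite -ler_pdivrMr // mul1r.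
    rewrite -md -subr_ge0; have -> : 2 * (C + 1) * m - (m + m) * C = 2 * m by ring.
    by rewrite mulr_ge0 // ltW.
- by move=> s s01; case: (lims s s01).
Qed.

Let sample_limit (y : nat -> nat -> 'rV[R]_n) (K : R) :
  (forall j k, (k <= j.+1)%N -> forall i, `|y j k 0 i| <= K) ->
  exists Y : R -> 'rV[R]_n, forall s, 0 <= s <= 1 -> sample j.+1 (y j) s @[j --> U] --> Y s.
Proof.
move=> yK.
have /choice[Y HY] : forall s : R, exists l : 'rV[R]_n,
    0 <= s <= 1 -> sample j.+1 (y j) s @[j --> U] --> l.
  move=> s; have [s01|s01] := boolP (0 <= s <= 1); last by exists 0.
  have [|l ll] := @ultra_cvg_bounded_mx R U UU 1 n (fun j => sample j.+1 (y j) s) K.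
    by move=> j i k; rewrite ord1; apply: yK; exact: truncn01_le.
  by exists l.
by exists Y.
Qed.

Let lag_bound t x y : enorm y <= r -> `|lagrangian t x y| <= C + n%:R * (r * C).
Proof.
move=> yr; have [h1 _ h2] := HC t x y.
apply: le_trans (ler_normB _ _) _; apply: lerD => //.
apply: le_trans (dot_le_norm _ _) _; rewrite ler_wpM2l // ler_pM //.
exact: le_trans (norm_le_enorm _) yr.
Qed.

Lemma lagrangian_unif eps : 0 < eps -> exists2 delta, 0 < delta & forall t t' q q' p p',
     `|t - t'| <= delta -> `|q - q'| <= delta -> `|p - p'| <= delta ->
     enorm p <= r -> enorm p' <= r -> `|lagrangian t q p - lagrangian t' q' p'| <= eps.
Proof.
move=> eps0.
have /andP[r0 _] := tame_radius tH.
have B0 : 0 < 1 + n%:R * C + n%:R * r.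
  by rewrite -addrA ltr_pwDl // addr_ge0 // mulr_ge0 // ltW.
pose eta := eps / (1 + n%:R * C + n%:R * r).
have eta0 : 0 < eta by rewrite divr_gt0.
have etaE : eps = eta + n%:R * (eta * C) + n%:R * (r * eta).
  by rewrite /eta; field; rewrite gt_eqF.
have [d d0 Hd] := tame_unif tH eta0.
exists (Num.min d eta); first by rewrite lt_min d0.
move=> t t' x x' y y'; rewrite !le_min => /andP[td _] /andP[xd _] /andP[yd ye] yr yr'.
have [h1 _ h2] := Hd _ _ _ _ _ _ td xd yd.
have [_ _ b] := HC t x y.
rewrite /lagrangian.
have -> : H t x y - dot y (Hp t x y) - (H t' x' y' - dot y' (Hp t' x' y')) =
   (H t x y - H t' x' y') - dot (y - y') (Hp t x y) - dot y' (Hp t x y - Hp t' x' y').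
  by rewrite dotBl dotBr; ring.
rewrite etaE; apply: le_trans (ler_normB _ _) _; apply: lerD.
  apply: le_trans (ler_normB _ _) _; apply: lerD => //.
  by apply: le_trans (dot_le_norm _ _) _; rewrite ler_wpM2l // ler_pM.
apply: le_trans (dot_le_norm _ _) _; rewrite ler_wpM2l // ler_pM //.
exact: le_trans (norm_le_enorm _) yr'.
Qed.

Lemma limit_orbit : exists (Q P : R -> 'rV[R]_n) (S : R -> R),
  [/\ forall t, 0 <= t <= 1 -> enorm (P t) <= r,
      forall t, 0 <= t <= 1 -> [/\ has_velocity01 Q t (Hp t (Q t) (P t)),
        has_velocity01 P t (- Hq t (Q t) (P t)) &
        has_velocity01 (S : R -> R^o) t (lagrangian t (Q t) (P t))],
      Q 1 = Q 0 + e, P 1 = P 0 & c <= S 1 - S 0].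
Proof.
have lip1 j k : (k <= j.+1)%N -> `|k%:R - 0%:R| / j.+1%:R * C <= C.
  move=> kj; rewrite subr0 ger0_norm // ler_piMl // ler_pdivrMr ?ltr0n // mul1r.
  by rewrite ler_nat.
have [|Q HQ] := @sample_limit q (C + 1).
  move=> j k kj i.
  have -> : q j k 0 i = (q j k - q j 0%N) 0 i + q j 0%N 0 i by rewrite !mxE subrK.
  apply: le_trans (ler_normD _ _) _; apply: lerD.
    apply: le_trans (le_mx_norm _ _ _) _; apply: le_trans (lip1 j k kj).
    exact: q_lip.
  by have /andP[a b] := q01 j i; rewrite ger0_norm.
have [|P HP] := @sample_limit p r.
  move=> j k _ i; apply: le_trans (pr j k).
  exact: le_trans (le_mx_norm _ _ _) (norm_le_enorm _).
pose L j (k : nat) : R := lagrangian (k%:R / j.+1%:R) (q j k) (p j k.+1).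
pose s j (k : nat) : 'rV[R]_1 := \row__ \sum_(i < k) j.+1%:R^-1 * L j i.
have [S HS] : exists S : R -> R, forall t, 0 <= t <= 1 ->
    sample j.+1 (fun k => s j k 0 0) t @[j --> U] --> S t.
  have /choice[S HS] : forall t : R, exists l : R,
      0 <= t <= 1 -> sample j.+1 (fun k => s j k 0 0) t @[j --> U] --> l.
    move=> t; have [t01|t01] := boolP (0 <= t <= 1); last by exists 0.
    have [|l ll] := @ultra_cvg_bounded R U UU (fun j => sample j.+1 (fun k => s j k 0 0) t)
       (C + n%:R * (r * C)).
      move=> j; rewrite /sample mxE; set m := Num.truncn _.
      have mj : (m <= j.+1)%N by exact: truncn01_le.
      apply: le_trans (ler_norm_sum _ _ _) _.
      have K0 : 0 <= C + n%:R * (r * C).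
        have /andP[r0 _] := tame_radius tH.
        by rewrite addr_ge0 // !mulr_ge0 // ltW.
      apply: (@le_trans _ _ (\sum_(i < m) j.+1%:R^-1 * (C + n%:R * (r * C)))).
        apply: ler_sum => i _; rewrite normrM ger0_norm ?invr_ge0 // ler_wpM2l ?invr_ge0 //.
        exact: lag_bound.
      rewrite sumr_const card_ord -[leLHS]mulr_natl mulrA ler_piMl //.
      by rewrite ler_pdivrMr ?ltr0n // mul1r ler_nat.
    by exists l.
  by exists S.
have Pr t : 0 <= t <= 1 -> enorm (P t) <= r.
  move=> t01; have ec := @enorm_continuous R n.
  apply: (cvgr_to_le (cvg_comp _ _ (HP t t01) (ec (P t)))).
  by apply: filterE => j; exact: pr.
have endp (V : normedModType R) (y : nat -> nat -> V) j :
    sample j.+1 (y j) 0 = y j 0%N /\ sample j.+1 (y j) 1 = y j j.+1.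
  by rewrite /sample mul0r mul1r natrK truncn0.
have i01 : 0 <= (0 : R) <= 1 by apply/andP; split; [exact: lexx|exact: ler01].
have i11 : 0 <= (1 : R) <= 1 by apply/andP; split; [exact: ler01|exact: lexx].
exists Q, P, S; split => //.
- move=> t t01; split.
  + apply: (@orbit_component _ Hp q Q Q P C t) => //; last by exact: Pr.
      by move=> t' x y _; case: (HC t' x y).
      move=> eps eps0; have [d d0 Hd] := tame_unif tH eps0; exists d => //.
      by move=> ? ? ? ? ? ? a b c' _ _; case: (Hd _ _ _ _ _ _ a b c').
    by move=> s' s01; split; [exact: HQ|exact: HP|exact: HQ].
  + apply: (@orbit_component _ (fun t x y => - Hq t x y) p P Q P C t) => //; last by exact: Pr.
      by move=> t' x y _; rewrite normrN; case: (HC t' x y).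
      move=> eps eps0; have [d d0 Hd] := tame_unif tH eps0; exists d => //.
      by move=> ? ? ? ? ? ? a b c' _ _; rewrite -opprD normrN; case: (Hd _ _ _ _ _ _ a b c').
    by move=> s' s01; split; [exact: HQ|exact: HP|exact: HP].
  + apply: (@orbit_component R^o lagrangian (fun j k => s j k 0 0) S Q P (C + n%:R * (r * C)) t) => //; last by exact: Pr.
      by move=> eps eps0; exact: lagrangian_unif.
      by move=> j k _; rewrite !mxE big_ord_recr.
    by move=> s' s01; split; [exact: HQ|exact: HP|exact: HS].
- have lim1 : sample j.+1 (q j) 1 @[j --> U] --> Q 0 + e.
    rewrite (_ : (fun j => _) = fun j => sample j.+1 (q j) 0 + e).
      by apply: cvgD; [exact: HQ|exact: cvg_cst].
    by apply/funext => j; have [-> ->] := endp _ q j.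
  exact: (cvg_unique _ (HQ 1 i11) lim1).
- have lim1 : sample j.+1 (p j) 1 @[j --> U] --> P 0.
    rewrite (_ : (fun j => _) = fun j => sample j.+1 (p j) 0); first exact: HP.
    by apply/funext => j; have [-> ->] := endp _ p j.
  exact: (cvg_unique _ (HP 1 i11) lim1).
- have SL : s j j.+1 0 0 - s j 0%N 0 0 @[j --> U] --> S 1 - S 0.
    rewrite (_ : (fun j => _) = fun j => sample j.+1 (fun k => s j k 0 0) 1
      - sample j.+1 (fun k => s j k 0 0) 0).
      exact: (cvgB (HS 1 i11) (HS 0 i01)).
    by apply/funext => j; rewrite /sample mul0r mul1r natrK truncn0.
  apply: (cvgr_to_ge SL); apply: filterE => j.
  by rewrite !mxE big_ord0 subr0; exact: q_action.
Qed.

End LimitOrbit.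

(** * Derivatives and integrals on the unit interval *)

Theorem tame_solution (R : realType) (n : nat) (r c : R)
    (H : R -> 'rV[R]_n -> 'rV[R]_n -> R) (Hq Hp : R -> 'rV[R]_n -> 'rV[R]_n -> 'rV[R]_n)
    (e : 'rV[R]_n) :
  tame_hamiltonian r H Hq Hp ->
  (forall t q, 0 <= t <= 1 -> c <= H t q 0) -> enorm e <= c ->
  exists (Q P : R -> 'rV[R]_n) (S : R -> R),
  [/\ forall t, 0 <= t <= 1 -> enorm (P t) <= r,
      forall t, 0 <= t <= 1 -> [/\ has_velocity01 Q t (Hp t (Q t) (P t)),
        has_velocity01 P t (- Hq t (Q t) (P t)) &
        has_velocity01 (S : R -> R^o) t (lagrangian H Hp t (Q t) (P t))],
      Q 1 = Q 0 + e, P 1 = P 0 & c <= S 1 - S 0].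
Proof.
move=> tH cH ec; have [C HC] := tame_bounded tH.
have orb j : exists z : (nat -> 'rV[R]_n) * (nat -> 'rV[R]_n),
  [/\ (forall i, 0 <= z.1 0%N 0 i <= 1) /\ (forall k, enorm (z.2 k) <= r),
      z.1 j.+1 = z.1 0%N + e /\ z.2 j.+1 = z.2 0%N,
      forall k, (k < j.+1)%N ->
        z.1 k.+1 = z.1 k + j.+1%:R^-1 *: Hp (k%:R / j.+1%:R) (z.1 k) (z.2 k.+1) /\
        z.2 k.+1 = z.2 k - j.+1%:R^-1 *: Hq (k%:R / j.+1%:R) (z.1 k) (z.2 k.+1) &
      c <= \sum_(k < j.+1) j.+1%:R^-1 * lagrangian H Hp (k%:R / j.+1%:R) (z.1 k) (z.2 k.+1)].
  by have [q [p h]] := discrete_orbit tH (ltn0Sn j) cH ec; exists (q, p).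
have /choice[z zP] := orb.
have [U [UU oU]] := ultra_nat.
apply: (@limit_orbit R n r c C H Hq Hp e tH HC (fun j => (z j).1) (fun j => (z j).2) _ _ _ _ _ _ _ U UU oU) => j.
- by case: (zP j) => -[].
- by case: (zP j) => -[].
- by case: (zP j) => _ [].
- by case: (zP j) => _ [].
- by move=> k kj; case: (zP j) => _ _ /(_ k kj)[].
- by move=> k kj; rewrite scalerN; case: (zP j) => _ _ /(_ k kj)[].
- by case: (zP j).
Qed.

Section Velocity01.
Variable R : realType.

Lemma has_velocity01_quotients n (x : R -> 'rV[R]_n) t a :
  has_velocity01 x t a -> quotients01 x t --> a.
Proof.
move=> xv; apply/cvgrPdist_le => eps eps0; have [d d0 Hd] := xv eps eps0.
have : \forall s \near nbhs t, `|t - s| <= d.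
  by apply: (@cvgr_dist_le _ _ _ (nbhs t) _ id t) => //; exact: cvg_id.
apply: filterS => s ts /eqP st /=; rewrite in_itv /= => s01.
have := Hd s s01; rewrite distrC => /(_ ts) h.
have st0 : s - t != 0 by rewrite subr_eq0; apply/eqP => E; apply: st; rewrite E.
have -> : a - (s - t)^-1 *: (x s - x t) = - (s - t)^-1 *: (x s - x t - (s - t) *: a).
  by rewrite [RHS]scalerBr scalerA mulNr mulVf // scaleN1r opprK scaleNr addrC.
rewrite normrZ normrN normrV ?unitfE // -ler_pdivlMl ?invr_gt0 ?normr_gt0 // invrK.
by rewrite mulrC (distrC s t).
Qed.

(** The filter of one-sided difference quotients is proper at every time of the
    interval, so that [velocity], a limit along it, is well determined. *)
Lemma within01_dnbhs_proper (t : R) : 0 <= t <= 1 ->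
  ProperFilter (within `[0, 1]%classic t^').
Proof.
move=> /andP[t0 t1]; apply: Build_ProperFilter_ex => A.
rewrite /within /= => /nbhs_ballP[d /= d0 dA].
have m0 : 0 < Num.min (d / 2) 2^-1 by rewrite lt_min divr_gt0 //= invr_gt0.
have md : Num.min (d / 2) 2^-1 < d.
  by rewrite gt_min ltr_pdivrMr // ltr_pMr // ltr1n.
have mh : Num.min (d / 2) 2^-1 <= 2^-1 by rewrite ge_min lexx orbT.
set m := Num.min _ _ in m0 md mh.
have [th|th] := leP t 2^-1.
  exists (t + m); apply: dA.
  - by rewrite /ball /= opprD addrA subrr sub0r normrN gtr0_norm.
  - by rewrite gt_eqF // ltrDl.
  - by rewrite /= in_itv /=; apply/andP; split; lra.
exists (t - m); apply: dA.
- by rewrite /ball /= opprB addrCA subrr addr0 gtr0_norm.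
- by rewrite lt_eqF // ltrBlDr ltrDl.
- by rewrite /= in_itv /=; apply/andP; split; lra.
Qed.

Lemma has_velocity01_velocity n (x : R -> 'rV[R]_n) t a : 0 <= t <= 1 ->
  has_velocity01 x t a -> velocity x t = a.
Proof.
move=> t01 /has_velocity01_quotients xa.
have pf := within01_dnbhs_proper t01.
by apply: cvg_lim xa; exact: norm_hausdorff.
Qed.

Lemma has_velocity01_continuous (V : normedModType R) (x : R -> V) t a eps :
  has_velocity01 x t a -> 0 < eps -> exists2 d, 0 < d & forall s, 0 <= s <= 1 ->
    `|s - t| <= d -> `|x s - x t| <= eps.
Proof.
move=> xv eps0; have [d d0 Hd] := xv _ ltr01.
have K0 : 0 < 1 + `|a| by rewrite ltr_pwDl.
exists (Num.min d (eps / (1 + `|a|))); first by rewrite lt_min d0 divr_gt0.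
move=> s s01; rewrite le_min => /andP[sd]; rewrite ler_pdivlMr // => se.
have -> : x s - x t = (x s - x t - (s - t) *: a) + (s - t) *: a by rewrite subrK.
apply: le_trans (ler_normD _ _) _; apply: le_trans se.
rewrite mulrDr mulr1 normrZ lerD2r.
by have := Hd s s01 sd; rewrite mul1r.
Qed.

Lemma within01_continuous (f : R -> R) :
  (forall t, 0 <= t <= 1 -> forall eps, 0 < eps -> exists2 d, 0 < d & forall s, 0 <= s <= 1 ->
    `|s - t| <= d -> `|f s - f t| <= eps) ->
  {within `[0, 1]%classic, continuous f}.
Proof.
move=> fc; apply/subspace_continuousP => t; rewrite /= in_itv /= => t01.
apply/cvgrPdist_le => eps eps0; have [d d0 Hd] := fc t t01 eps eps0.
have : \forall s \near nbhs t, `|t - s| <= d.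
  by apply: (@cvgr_dist_le _ _ _ (nbhs t) _ id t) => //; exact: cvg_id.
by apply: filterS => s ts; rewrite /= in_itv /= distrC => s01; apply: Hd => //; rewrite distrC.
Qed.

Lemma has_velocity01_derive (S : R -> R) t a : 0 < t < 1 ->
  has_velocity01 (S : R -> R^o) t a -> is_derive t 1 S a.
Proof.
move=> /andP[t0 t1] Sv.
have L : h^-1 *: ((S \o shift t) (h *: 1) - S t) @[h --> 0^'] --> a.
  apply/cvgrPdist_le => eps eps0; have [d d0 Hd] := Sv eps eps0.
  have m0 : 0 < Num.min d (Num.min t (1 - t)) by rewrite !lt_min d0 t0 subr_gt0.
  have : \forall h \near nbhs (0 : R), `|0 - h| <= Num.min d (Num.min t (1 - t)).
    by apply: (@cvgr_dist_le _ _ _ (nbhs (0 : R)) _ id 0) => //; exact: cvg_id.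
  apply: filterS => h; rewrite sub0r normrN !le_min => /and3P[hd ht h1] hn0 /=.
  have h0 : h != 0 by [].
  rewrite -[h *: 1]/(h * 1) mulr1.
  have := Hd (h + t); rewrite addrK => /(_ _ hd).
  have s01 : 0 <= h + t <= 1.
    by move: ht h1; rewrite !ler_norml => /andP[? ?] /andP[? ?]; apply/andP; split; lra.
  move=> /(_ s01) b.
  have -> : a - h^-1 *: (S (h + t) - S t) = - h^-1 * (S (h + t) - S t - h * a).
    by rewrite -[_ *: (_ - _)]/(_ * _); field.
  rewrite normrM normrN normrV ?unitfE // -ler_pdivlMl ?invr_gt0 ?normr_gt0 // invrK.
  by rewrite (mulrC _ eps); exact: b.
apply: DeriveDef; first by apply/cvg_ex; exists a.
by rewrite /derive; apply: cvg_lim L; exact: norm_hausdorff.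
Qed.

Lemma integral_has_velocity01 (S f : R -> R) :
  {within `[0, 1]%classic, continuous f} ->
  (forall t, 0 <= t <= 1 -> has_velocity01 (S : R -> R^o) t (f t)) ->
  \int[lebesgue_measure]_(t in `[0, 1]%classic) f t = S 1 - S 0.
Proof.
move=> fc Sv; rewrite /Rintegral (@continuous_FTC2 R f S 0 1) ?ltr01 //.
- have Sc : {within `[0, 1]%classic, continuous S}.
    apply: within01_continuous => t t01 eps eps0.
    exact: (has_velocity01_continuous (Sv t t01) eps0).
  have [_ S0 S1] := (continuous_within_itvP S ltr01).1 Sc.
  split => // t; rewrite in_itv /= => t01.
  have /andP[t0 t1] := t01.
  have := Sv t; rewrite !ltW // => /(_ isT) /(has_velocity01_derive t01) D.
  exact: (@ex_derive _ _ _ _ _ _ _ D).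
- move=> t; rewrite in_itv /= => t01; have /andP[t0 t1] := t01.
  have := Sv t; rewrite !ltW // => /(_ isT) /(has_velocity01_derive t01) D.
  by rewrite derive1E; exact: (@derive_val _ _ _ _ _ _ _ D).
Qed.

End Velocity01.

(** * First-order expansions and uniform continuity *)

Section CoordinateExpansion.
Variables (R : realType) (m : nat) (F : 'rV[R]_m -> R) (dF : 'rV[R]_m -> 'rV[R]_m).
Hypothesis F_derive : forall x i (s : R),
  is_derive s 1 (fun s : R => F (x + s *: delta_mx 0 i)) (dF (x + s *: delta_mx 0 i) 0 i).
Variables eps delta : R.
Hypothesis dF_unif : forall x y, `|x - y| <= delta -> `|dF x - dF y| <= eps.

Let line_continuous x i : continuous (fun s : R => F (x + s *: delta_mx 0 i)).
Proof.
move=> s; apply: differentiable_continuous; apply/derivable1_diffP.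
exact: (@ex_derive _ _ _ _ _ _ _ (F_derive x i s)).
Qed.

Let mean_value x i (b : R) : exists2 s, `|s| <= `|b| &
  F (x + b *: delta_mx 0 i) - F x = dF (x + s *: delta_mx 0 i) 0 i * b.
Proof.
have cw a b' : {within `[a, b'], continuous (fun s : R => F (x + s *: delta_mx 0 i))}.
  exact: continuous_subspaceT.
have [b0|b0] := leP 0 b.
  have [s sb E] := MVT_segment b0 (fun s _ => F_derive x i s) (@cw 0 b).
  exists s; last by move: E; rewrite scale0r addr0 subr0.
  by move: sb; rewrite in_itv /= => /andP[s0 sb]; rewrite !ger0_norm.
have [s sb E] := MVT_segment (ltW b0) (fun s _ => F_derive x i s) (@cw b 0).
exists s.
  move: sb; rewrite in_itv /= => /andP[sb s0].
  by rewrite (ler0_norm s0) (ler0_norm (ltW b0)) lerN2.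
by move: E; rewrite scale0r addr0 sub0r mulrN => E; rewrite -opprB E opprK.
Qed.

(** The path from [x] to [x + a] that changes one coordinate at a time reduces the
    expansion to the mean value theorem in one variable. *)
Lemma coordinate_expand x a : `|a| <= delta ->
  `|F (x + a) - F x - dot (dF x) a| <= m%:R * (eps * `|a|).
Proof.
move=> ad.
pose c k : 'rV[R]_m := \row_i (if (i < k)%N then a 0 i else 0).
have cS (k : 'I_m) : c k.+1 = c k + a 0 k *: delta_mx 0 k.
  apply/rowP => i; rewrite !mxE eqxx /= ltnS leq_eqVlt val_eqE.
  have [->|ik] := eqVneq i k; last by rewrite mulr0 addr0.
  by rewrite ltnn add0r mulr1.
have cN : c m = a by apply/rowP => i; rewrite mxE ltn_ord.
have c0 : c 0%N = 0 by apply/rowP => i; rewrite !mxE.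
have T : F (x + a) - F x = \sum_(k < m) (F (x + c k.+1) - F (x + c k)).
  rewrite -(big_mkord xpredT (fun k => F (x + c k.+1) - F (x + c k))).
  rewrite (telescope_sumr (fun k => F (x + c k))) //=.
  by rewrite cN c0 addr0.
rewrite T /dot -sumrB; apply: le_trans (ler_norm_sum _ _ _) _.
rewrite mulr_natl -[X in _ *+ X]card_ord -sumr_const; apply: ler_sum => k _.
rewrite cS addrA; have [s sa ->] := mean_value (x + c k) k (a 0 k).
rewrite -mulrBl normrM; apply: ler_pM => //; last exact: le_mx_norm.
have : `|dF (x + c k + s *: delta_mx 0 k) - dF x| <= eps.
  apply: dF_unif; rewrite addrAC [x + c k]addrC addrK.
  apply: le_trans ad; apply/mx_norm_leP => // i j; rewrite !mxE ord1.
  have [->|jk] := eqVneq j k.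
    by rewrite ltnn add0r eqxx mulr1 (le_trans sa) // le_mx_norm.
  by rewrite mulr0 addr0; case: ifP => _; [exact: le_mx_norm|rewrite normr0].
by apply: le_trans; apply: le_trans (le_mx_norm _ 0 k); rewrite !mxE.
Qed.

End CoordinateExpansion.

Section PeriodicCompact.
Variables (R : realType) (n : nat) (V : normedModType R).
Notation phase := (R * 'rV[R]_n * 'rV[R]_n)%type.
Variable f : phase -> V.

Definition clamp01 (t : R) : R := Num.max 0 (Num.min t 1).

Lemma clamp01_in t : 0 <= clamp01 t <= 1.
Proof. by rewrite /clamp01 le_max lexx /= ge_max ler01 ge_min lexx orbT. Qed.

Lemma clamp01_id t : 0 <= t <= 1 -> clamp01 t = t.
Proof. by move=> /andP[t0 t1]; rewrite /clamp01 (min_idPl t1); apply/max_idPr. Qed.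

Lemma clamp01_lipschitz t t' : `|clamp01 t - clamp01 t'| <= `|t - t'|.
Proof.
have := ler_norm (t - t'); have := ler_norm (t' - t); rewrite (distrC t' t).
have m1 : Num.max 0 1 = 1 :> R by exact/max_idPr.
rewrite /clamp01 ler_norml.
by have [?|?] := leP t 1; have [?|?] := leP t' 1; rewrite ?m1;
  have [?|?] := leP 0 t; have [?|?] := leP 0 t'; move=> ? ?; apply/andP; split; lra.
Qed.

Hypothesis f_cont : continuous f.
Hypothesis f_clamp : forall t q p, f (t, q, p) = f (clamp01 t, q, p).
Hypothesis f_periodic : forall t q p (k : 'rV[int]_n), f (t, q + vecZ R k, p) = f (t, q, p).
Hypothesis f_supp : forall t q p, 1 <= enorm p -> f (t, q, p) = 0.

(* adding [cell q] moves [q] into the unit cube *)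
Let cell (q : 'rV[R]_n) : 'rV[int]_n := \row_i - Num.floor (q 0 i).

Let cell_norm q : `|q + vecZ R (cell q)| <= 1.
Proof.
apply/mx_norm_leP => // i j; rewrite !mxE ord1 mulrNz.
rewrite ger0_norm ?subr_ge0 ?floor_le // lerBlDr.
by rewrite addrC -[1]/(1%:~R) -intrD ltW // floorD1_gt.
Qed.

Let phase_ultralimit (U : set_system nat) (UU : UltraFilter U) (z : nat -> phase) (K : R) :
  (forall j, [/\ `|(z j).1.1| <= K, `|(z j).1.2| <= K & `|(z j).2| <= K]) ->
  exists l : phase, z @ U --> l.
Proof.
move=> zK.
have [|t tl] := @ultra_cvg_bounded R U UU (fun j => (z j).1.1) K.
  by move=> j; case: (zK j).
have [|q ql] := @ultra_cvg_bounded_mx R U UU _ _ (fun j => (z j).1.2) K.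
  by move=> j i k; apply: le_trans (le_mx_norm _ _ _) _; case: (zK j).
have [|p pl] := @ultra_cvg_bounded_mx R U UU _ _ (fun j => (z j).2) K.
  by move=> j i k; apply: le_trans (le_mx_norm _ _ _) _; case: (zK j).
exists (t, q, p).
have -> : z = (fun j => (((z j).1.1, (z j).1.2), (z j).2)).
  by apply/funext => j; case: (z j) => -[].
exact: (cvg_pair (cvg_pair tl ql) pl).
Qed.

(** A failure of uniform continuity would be witnessed by pairs of points that, after
    clamping the time and an integer translation, stay in a bounded region; both
    members of the pairs would converge to the same point, against continuity there. *)
Lemma periodic_unif eps : 0 < eps -> exists2 delta, 0 < delta &
  forall t t' q q' p p', `|t - t'| <= delta -> `|q - q'| <= delta -> `|p - p'| <= delta ->
  `|f (t, q, p) - f (t', q', p')| <= eps.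
Proof.
move=> eps0; apply: contrapT => H.
have bad (j : nat) : exists z : phase * phase,
    [/\ `|z.1.1.1| <= 2 /\ `|z.1.1.2| <= 2, `|z.1.2| <= 2, `|z.1 - z.2| <= 1 / j.+1%:R &
      eps <= `|f z.1 - f z.2|].
  apply: contrapT => B; apply: H; exists (1 / j.+1%:R); first by rewrite divr_gt0.
  move=> t t' q q' p p' tt qq pp; rewrite leNgt; apply/negP => lt; apply: B.
  exists ((clamp01 t, q + vecZ R (cell q), p), (clamp01 t', q' + vecZ R (cell q), p')).
  rewrite !f_periodic -!f_clamp /=; split; last exact: ltW.
  - split; last by apply: le_trans (cell_norm q) _; lra.
    by have /andP[a b] := clamp01_in t; rewrite ger0_norm //; lra.
  - have j1 : 1 / j.+1%:R <= 1 :> R by rewrite ler_pdivrMr ?ltr0n // mul1r ler1n.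
    have [p1|p1] := ltP (enorm p) 1.
      by apply: le_trans (norm_le_enorm p) _; lra.
    have [p1'|p1'] := ltP (enorm p') 1.
      have -> : p = p' + (p - p') by rewrite addrC subrK.
      apply: le_trans (ler_normD _ _) _.
      rewrite -[2]/(1 + 1 : R); apply: lerD; last exact: le_trans pp j1.
      exact: le_trans (norm_le_enorm p') (ltW p1').
    by move: lt; rewrite !f_supp // subrr normr0 ltNge (ltW eps0).
  - rewrite prod_normE ge_max pp andbT prod_normE ge_max /= opprD addrACA subrr addr0 qq andbT.
    exact: le_trans (clamp01_lipschitz t t') tt.
have /choice[z zP] := bad.
have [U [UU oU]] := ultra_nat.
have [|l zl] := phase_ultralimit UU (z := fun j => (z j).1) (K := 2).
  by move=> j; case: (zP j) => -[].
have z'l : (fun j => (z j).2) @ U --> l.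
  have d0 : (fun j => (z j).1 - (z j).2) @ U --> (0 : phase).
    apply: (ultra_cvg oU); apply/cvgr0Pnorm_le => e e0.
    have h : (j.+1%:R^-1 : R) @[j --> \oo] --> (0 : R) by exact: (@cvg_harmonic R).
    have : \forall j \near \oo, (j.+1%:R^-1 : R) <= e by exact: (cvgr_le 0 h).
    apply: filterS => j je; case: (zP j) => _ _ /le_trans + _; apply.
    by rewrite mul1r.
  have -> : (fun j => (z j).2) = (fun j => (z j).1 - ((z j).1 - (z j).2)).
    by apply/funext => j; rewrite opprB addrC subrK.
  by rewrite -[l]subr0; exact: cvgB.
have c1 := cvg_comp _ _ zl (f_cont (x := l)).
have c2 := cvg_comp _ _ z'l (f_cont (x := l)).
have c3 : `|f (z j).1 - f (z j).2| @[j --> U] --> `|f l - f l| by exact: (cvg_norm (cvgB c1 c2)).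
have : eps <= `|f l - f l|.
  by apply: (cvgr_to_ge c3); apply: filterE => j; case: (zP j).
by rewrite subrr normr0 leNgt eps0.
Qed.

Lemma periodic_bounded : exists C, forall t q p, `|f (t, q, p)| <= C.
Proof.
apply: contrapT => H.
have bad (j : nat) : exists z : phase,
    [/\ `|z.1.1| <= 1, `|z.1.2| <= 1 & `|z.2| <= 1] /\ j%:R <= `|f z|.
  apply: contrapT => B; apply: H; exists j%:R => t q p; rewrite leNgt; apply/negP => lt.
  apply: B; exists (clamp01 t, q + vecZ R (cell q), p).
  rewrite f_periodic -f_clamp /=; split; last exact: ltW.
  split; [|exact: cell_norm|].
    by have /andP[a b] := clamp01_in t; rewrite ger0_norm.
  apply: le_trans (norm_le_enorm p) _; rewrite leNgt; apply/negP => p1.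
  by move: lt; rewrite f_supp ?(ltW p1) // normr0 ltrn0.
have /choice[z zP] := bad.
have [U [UU oU]] := ultra_nat.
have [|l zl] := phase_ultralimit UU (z := z) (K := 1); first by move=> j; case: (zP j).
have c0 := cvg_comp _ _ zl (f_cont (x := l)).
have c1 : `|f (z j)| @[j --> U] --> `|f l| by exact: (cvg_norm c0).
pose M := (Num.truncn (`|f l|)).+2.
have : M%:R <= `|f l| :> R.
  apply: (cvgr_to_ge c1).
  have : \forall j \near U, (M <= j)%N by apply: oU; exact: nbhs_infty_ge.
  apply: filterS => j Mj; case: (zP j) => _; apply: le_trans.
  by rewrite ler_nat.
rewrite leNgt => /negP; apply; apply: (lt_trans (truncnS_gt _)).
by rewrite ltr_nat.
Qed.

End PeriodicCompact.

(** * Extension of the Hamiltonian by zero *)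

Section TameExtension.
Variables (R : realType) (n : nat) (H : extended_phase R n -> R).
Hypothesis H_periodic : torus_periodic H.
Hypothesis H_smooth : smooth_on (@time_phase R n) H.
Hypothesis H_supp : compactly_supported H.
Notation vec := 'rV[R]_n.
Notation phase := (extended_phase R n).

(** Clamping the time makes the extension continuous on the whole space, so that
    the one-sided limits at the times [0] and [1] become ordinary ones. *)
Definition extension (V : normedModType R) (F : R -> vec -> vec -> V) t q p : V :=
  if enorm p < 1 then F (clamp01 t) q p else 0.

Let snd_cont : continuous (fun z : phase => z.2).
Proof. exact: continuous_snd. Qed.

Let enorm_snd_cont : continuous (fun z : phase => enorm z.2).
Proof. exact: (continuous_compose snd_cont (@enorm_continuous R n)). Qed.

Let near_lt (T : topologicalType) (f : T -> R) (x : T) a : continuous f -> f x < a ->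
  \forall y \near x, f y < a.
Proof. by move=> fc fa; exact: (cvgr_lt (f x) (fc x)). Qed.

Let near_gt (T : topologicalType) (f : T -> R) (x : T) a : continuous f -> a < f x ->
  \forall y \near x, a < f y.
Proof. by move=> fc fa; exact: (cvgr_gt (f x) (fc x)). Qed.

(** Translations do not change the momentum, so a bound on the momentum over the
    compact set [K] bounds it on the whole support. *)
Lemma support_radius : exists2 r, 0 < r < 1 & forall t q p, 0 <= t <= 1 ->
  r < enorm p -> enorm p < 1 -> H (t, q, p) = 0.
Proof.
have [K [Kc Kt HK]] := H_supp.
have [r /andP[r0 r1] Kr] : exists2 r, 0 < r < 1 & forall z, K z -> enorm z.2 <= r.
  have [[z0 Kz0]|K0] := pselect (K !=set0); last first.
    exists 2^-1; first by rewrite invr_gt0 ltr0n /= invf_lt1 ?ltr0n // ltr1n.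
    by move=> z Kz; case: K0; exists z.
  have [||z Kz zmax] := compact_EVT_max (f := fun z : phase => enorm z.2) (A := K) _ Kc.
  - by exists z0.
  - exact: continuous_subspaceT.
  have /Kt[_ z1] := set_mem Kz.
  exists (Num.max (enorm z.2) 2^-1).
    rewrite lt_max gt_max z1 invr_gt0 ltr0n orbT /= invf_lt1 ?ltr0n // ltr1n //.
  by move=> y Ky; rewrite le_max zmax // inE.
exists r; first by rewrite r0.
move=> t q p t01 rp p1; apply/eqP; apply: contraT => Hz.
have [|k Kk] := HK (t, q, p) _ Hz; first by split.
by have := Kr _ Kk; rewrite leNgt /= rp.
Qed.

Section Local.
Variables (U : set phase) (g : phase -> R).
Hypothesis g_smooth : smooth_on_open U g.
Hypothesis Hg : forall z, @time_phase R n z -> U z -> H z = g z.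

Let dirq i : phase := (0, delta_mx 0 i, 0).
Let dirp i : phase := (0, 0, delta_mx 0 i).

Lemma local_is_derive_q t q p i : @time_phase R n (t, q, p) -> U (t, q, p) ->
  is_derive q (delta_mx 0 i) (fun q' => H (t, q', p)) ('D_(dirq i) g (t, q, p)).
Proof.
move=> tz Uz; have [Uo gd] := g_smooth.
have /= [_ /(_ (dirq i)) Dg] := gd [::] _ Uz.
have mc : continuous (fun q' : vec => (t, q', p) : phase).
  by move=> x; exact: (cvg_pair (cvg_pair (cvg_cst t) (@cvg_id _ (nbhs x))) (cvg_cst p)).
apply: (@near_eq_is_derive _ _ _ (fun q' => g (t, q', p))).
  have : \forall q' \near q, U (t, q', p) by apply: mc; exact: open_nbhs_nbhs.
  by apply: filterS => q' Uq'; rewrite Hg.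
have E : (fun h : R => h^-1 *: (((fun q' => g (t, q', p)) \o shift q) (h *: delta_mx 0 i) - g (t, q, p)))
   = (fun h : R => h^-1 *: ((g \o shift (t, q, p)) (h *: dirq i) - g (t, q, p))).
  apply/funext => h /=; congr (_ *: (g _ - _)).
  by rewrite /dirq; congr (_, _, _); rewrite /= ?scaler0 ?add0r //.
by apply: DeriveDef; rewrite /derivable /derive /= E.
Qed.

Lemma local_is_derive_p t q p i : @time_phase R n (t, q, p) -> U (t, q, p) ->
  is_derive p (delta_mx 0 i) (fun p' => H (t, q, p')) ('D_(dirp i) g (t, q, p)).
Proof.
move=> tz Uz; have [Uo gd] := g_smooth.
have /= [_ /(_ (dirp i)) Dg] := gd [::] _ Uz.
have mc : continuous (fun p' : vec => (t, q, p') : phase).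
  by move=> x; exact: (cvg_pair (cvg_cst (t, q)) (@cvg_id _ (nbhs x))).
apply: (@near_eq_is_derive _ _ _ (fun p' => g (t, q, p'))).
  have h1 : \forall p' \near p, U (t, q, p') by apply: mc; exact: open_nbhs_nbhs.
  have h2 : \forall p' \near p, enorm p' < 1.
    by apply: near_lt; [exact: enorm_continuous|case: tz].
  apply: filterS2 h1 h2 => p' Up' p'1; rewrite Hg //.
  by case: tz => t01 _; split.
have E : (fun h : R => h^-1 *: (((fun p' => g (t, q, p')) \o shift p) (h *: delta_mx 0 i) - g (t, q, p)))
   = (fun h : R => h^-1 *: ((g \o shift (t, q, p)) (h *: dirp i) - g (t, q, p))).
  apply/funext => h /=; congr (_ *: (g _ - _)).
  by rewrite /dirp; congr (_, _, _); rewrite /= ?scaler0 ?add0r //.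
by apply: DeriveDef; rewrite /derivable /derive /= E.
Qed.

Lemma local_continuity z : @time_phase R n z -> U z ->
  [/\ {for z, continuous g}, {for z, continuous (fun y => \row_i 'D_(dirq i) g y)} &
      {for z, continuous (fun y => \row_i 'D_(dirp i) g y)}].
Proof.
move=> tz Uz; have [Uo gd] := g_smooth.
split; first by have [] := gd [::] _ Uz.
- apply: cvg_mx => i j; rewrite mxE; have [/= c _] := gd [:: dirq j] _ Uz.
  by apply: cvg_trans c; apply: near_eq_cvg; apply: filterE => y; rewrite mxE.
- apply: cvg_mx => i j; rewrite mxE; have [/= c _] := gd [:: dirp j] _ Uz.
  by apply: cvg_trans c; apply: near_eq_cvg; apply: filterE => y; rewrite mxE.
Qed.

End Local.

Lemma is_derive_partial z : @time_phase R n z -> forall i,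
  is_derive z.1.2 (delta_mx 0 i) (fun q => H (z.1.1, q, z.2)) (partial_q H z.1.1 z.1.2 z.2 0 i) /\
  is_derive z.2 (delta_mx 0 i) (fun p => H (z.1.1, z.1.2, p)) (partial_p H z.1.1 z.1.2 z.2 0 i).
Proof.
case: z => -[t q] p /= tz i; have [U [g [Uz gs Hg]]] := H_smooth tz.
have Dq := local_is_derive_q gs Hg i tz Uz.
have Dp := local_is_derive_p gs Hg i tz Uz.
rewrite /partial_q /partial_p !mxE; split.
  by rewrite (@derive_val _ _ _ _ _ _ _ Dq).
by rewrite (@derive_val _ _ _ _ _ _ _ Dp).
Qed.

(** At the boundary times [H] and its derivatives are only known as restrictions of
    functions defined on a neighbourhood; continuity at these times means agreement
    with a continuous germ. *)
Definition germ_continuous (V : normedModType R) (F : R -> vec -> vec -> V) :=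
  forall z, @time_phase R n z -> exists2 G : phase -> V, {for z, continuous G} &
    \forall y \near z, @time_phase R n y -> F y.1.1 y.1.2 y.2 = G y.

Let Ht t q p := H (t, q, p).

Lemma germ_continuous_partial :
  [/\ germ_continuous Ht, germ_continuous (partial_q H) & germ_continuous (partial_p H)].
Proof.
have P z : @time_phase R n z -> exists U g, [/\ U z, smooth_on_open U g, (forall y, @time_phase R n y -> U y -> H y = g y)
  & \forall y \near z, U y].
  move=> tz; have [U [g [Uz gs Hg]]] := H_smooth tz; exists U, g; split=> //.
  by apply: open_nbhs_nbhs; split => //; case: gs.
split=> z tz; have [U [g [Uz gs Hg nU]]] := P z tz; have [c1 c2 c3] := local_continuity gs tz Uz.
- exists g => //; apply: filterS nU => -[[t q] p] /= Uy ty; exact: Hg.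
- exists (fun y => \row_i 'D_((0, delta_mx 0 i, 0) : phase) g y); first exact: c2.
  apply: filterS nU => -[[t q] p] /= Uy ty; apply/rowP => i; rewrite !mxE.
  exact: (@derive_val _ _ _ _ _ _ _ (local_is_derive_q gs Hg i ty Uy)).
- exists (fun y => \row_i 'D_((0, 0, delta_mx 0 i) : phase) g y); first exact: c3.
  apply: filterS nU => -[[t q] p] /= Uy ty; apply/rowP => i; rewrite !mxE.
  exact: (@derive_val _ _ _ _ _ _ _ (local_is_derive_p gs Hg i ty Uy)).
Qed.

Let clampz (z : phase) : phase := (clamp01 z.1.1, z.1.2, z.2).

Let clampz_cont : continuous clampz.
Proof.
have tc : continuous (fun z : phase => z.1.1).
  exact: (continuous_compose (@continuous_fst _ _) (@continuous_fst _ _)).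
have qc : continuous (fun z : phase => z.1.2).
  exact: (continuous_compose (@continuous_fst _ _) (@continuous_snd _ _)).
have cc : continuous (@clamp01 R).
  move=> t; apply/cvgrPdist_le => e e0.
  have : \forall s \near nbhs t, `|t - s| <= e.
    by apply: (@cvgr_dist_le _ _ _ (nbhs t) _ id t) => //; exact: cvg_id.
  by apply: filterS => s; apply: le_trans; exact: clamp01_lipschitz.
apply: continuous_pair => //; apply: continuous_pair => //.
exact: continuous_compose tc cc.
Qed.

(** For [|p| < 1] the extension is locally a continuous germ composed with the clamping
    of the time; for [|p| >= 1 > r] it is locally zero. *)
Lemma extension_continuous (V : normedModType R) (F : R -> vec -> vec -> V) r : r < 1 ->
  germ_continuous F ->
  (forall t q p, 0 <= t <= 1 -> r < enorm p -> enorm p < 1 -> F t q p = 0) ->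
  continuous (fun z : phase => extension F z.1.1 z.1.2 z.2).
Proof.
move=> r1 Fg Fs z.
have [z1|z1] := ltP (enorm z.2) 1.
  have tz : @time_phase R n (clampz z) by split; [exact: clamp01_in|].
  have [G Gc nG] := Fg _ tz.
  have ext_eq y : enorm y.2 < 1 -> (@time_phase R n (clampz y) -> F (clampz y).1.1 (clampz y).1.2 (clampz y).2 = G (clampz y)) ->
     extension F y.1.1 y.1.2 y.2 = G (clampz y).
    by move=> y1; rewrite /extension y1 /clampz /=; apply; split; [exact: clamp01_in|].
  have Ez := ext_eq z z1 (nbhs_singleton nG).
  change (extension F y.1.1 y.1.2 y.2 @[y --> z] --> extension F z.1.1 z.1.2 z.2); rewrite Ez.
  have c := continuous_comp (clampz_cont (x := z)) Gc.
  apply: cvg_trans c; apply: near_eq_cvg.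
  have h1 := near_lt enorm_snd_cont z1.
  have h2 := clampz_cont nG.
  by apply: filterS2 h1 h2 => y y1 hy; rewrite ext_eq.
have Ez : extension F z.1.1 z.1.2 z.2 = 0 by rewrite /extension ltNge z1.
change (extension F y.1.1 y.1.2 y.2 @[y --> z] --> extension F z.1.1 z.1.2 z.2); rewrite Ez.
have h1 := near_gt enorm_snd_cont (lt_le_trans r1 z1).
have c : (fun _ : phase => 0 : V) @ z --> (0 : V) by exact: cvg_cst.
apply: cvg_trans c; apply: near_eq_cvg.
apply: filterS h1 => y ry; rewrite /extension; case: ltP => // y1.
by rewrite Fs // clamp01_in.
Qed.

Lemma extension_in (V : normedModType R) (F : R -> vec -> vec -> V) t q p :
  0 <= t <= 1 -> enorm p < 1 -> extension F t q p = F t q p.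
Proof. by move=> t01 p1; rewrite /extension p1 clamp01_id. Qed.

Lemma partial_vanish r : (forall t q p, 0 <= t <= 1 ->
    r < enorm p -> enorm p < 1 -> H (t, q, p) = 0) ->
  forall t q p, 0 <= t <= 1 -> r < enorm p -> enorm p < 1 ->
  partial_q H t q p = 0 /\ partial_p H t q p = 0.
Proof.
move=> H0 t q p t01 rp p1; split; apply/rowP => i; rewrite !mxE.
  rewrite (near_eq_derive (g := cst 0)) ?derive_cst //.
  by apply: filterE => q'; rewrite H0.
rewrite (near_eq_derive (g := cst 0)) ?derive_cst //.
have h1 := near_lt (@enorm_continuous R n) p1; have h2 := near_gt (@enorm_continuous R n) rp.
by apply: filterS2 h1 h2 => p' p'1 rp'; rewrite H0.
Qed.

Lemma partial_periodic t q p (k : 'rV[int]_n) : 0 <= t <= 1 -> enorm p < 1 ->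
  partial_q H t (q + vecZ R k) p = partial_q H t q p /\
  partial_p H t (q + vecZ R k) p = partial_p H t q p.
Proof.
move=> t01 p1.
have per q' p' : enorm p' < 1 -> H (t, q' + vecZ R k, p') = H (t, q', p').
  by move=> p'1; apply: (H_periodic (z := (t, q', p'))); split.
split; apply/rowP => i; rewrite !mxE.
  rewrite /derive.
  have -> : (fun h : R => h^-1 *: (((fun q' => H (t, q', p)) \o shift (q + vecZ R k)) (h *: delta_mx 0 i)
      - H (t, q + vecZ R k, p))) =
    (fun h : R => h^-1 *: (((fun q' => H (t, q', p)) \o shift q) (h *: delta_mx 0 i) - H (t, q, p))).
    by apply/funext => h /=; rewrite addrA !per.
  by [].
apply: near_eq_derive; have h1 := near_lt (@enorm_continuous R n) p1.
by apply: filterS h1 => p' p'1; rewrite per.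
Qed.

Lemma is_derive_line (V : normedModType R) (f : V -> R) x v (s d : R) :
  is_derive (x + s *: v) v f d -> is_derive s 1 (fun s : R => f (x + s *: v)) d.
Proof.
move=> [fd fv].
have E : (fun h : R => h^-1 *: (((fun s : R => f (x + s *: v)) \o shift s) (h *: 1) - f (x + s *: v)))
   = (fun h : R => h^-1 *: ((f \o shift (x + s *: v)) (h *: v) - f (x + s *: v))).
  apply/funext => h /=; congr (_ *: (f _ - _)).
  by rewrite -[h *: 1]/(h * 1) mulr1 scalerDl addrCA addrA addrC addrA.
by apply: DeriveDef; rewrite /derivable /derive /= E.
Qed.

Lemma extension_derive_q t q p i (s : R) :
  is_derive s 1 (fun s : R => extension Ht t (q + s *: delta_mx 0 i) p)
    (extension (partial_q H) t (q + s *: delta_mx 0 i) p 0 i).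
Proof.
apply: (is_derive_line (f := fun q => extension Ht t q p)); rewrite /extension.
case: ltP => p1; last by rewrite mxE; exact: is_derive_cst.
have tz : @time_phase R n (clamp01 t, q + s *: delta_mx 0 i, p) by split; [exact: clamp01_in|].
by have [] := is_derive_partial tz i.
Qed.

Lemma extension_derive_p r t q p i (s : R) : r < 1 ->
  (forall t q p, 0 <= t <= 1 -> r < enorm p -> enorm p < 1 -> H (t, q, p) = 0) ->
  is_derive s 1 (fun s : R => extension Ht t q (p + s *: delta_mx 0 i))
    (extension (partial_p H) t q (p + s *: delta_mx 0 i) 0 i).
Proof.
move=> r1 H0; apply: (is_derive_line (f := fun p => extension Ht t q p)).
set y := p + _; rewrite {2}/extension; case: (ltP (enorm y)) => y1.
  have tz : @time_phase R n (clamp01 t, q, y) by split; [exact: clamp01_in|].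
  have [_ D] := is_derive_partial tz i.
  apply: near_eq_is_derive D; have h1 := near_lt (@enorm_continuous R n) y1.
  by apply: filterS h1 => p' p'1; rewrite /extension p'1.
rewrite mxE; apply: (near_eq_is_derive (f := cst 0)).
have h1 := near_gt (@enorm_continuous R n) (lt_le_trans r1 y1).
apply: filterS h1 => p' rp'; rewrite /extension; case: ltP => // p'1.
by rewrite /Ht H0 // clamp01_in.
Qed.

(** The expansion of [H] in [(q, p)] jointly is obtained by changing [q] first and [p]
    afterwards; the gradient in [q] is then evaluated at [p + b] instead of [p], which
    uniform continuity accounts for. *)
Theorem extension_tame : exists r,
  tame_hamiltonian r (extension Ht) (extension (partial_q H)) (extension (partial_p H)).
Proof.
have [r /andP[r0 r1] H0] := support_radius.
have [g1 g2 g3] := germ_continuous_partial.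
have v2 t q p t01 rp p1 := proj1 (@partial_vanish r H0 t q p t01 rp p1).
have v3 t q p t01 rp p1 := proj2 (@partial_vanish r H0 t q p t01 rp p1).
have c1 := extension_continuous r1 g1 H0.
have c2 := extension_continuous r1 g2 v2.
have c3 := extension_continuous r1 g3 v3.
have clampK (t : R) : clamp01 (clamp01 t) = clamp01 t by rewrite clamp01_id ?clamp01_in.
have ecl (V : normedModType R) (F : R -> vec -> vec -> V) t q p : extension F t q p = extension F (clamp01 t) q p.
  by rewrite /extension clampK.
have esupp (V : normedModType R) (F : R -> vec -> vec -> V) t q p : 1 <= enorm p -> extension F t q p = 0.
  by rewrite /extension ltNge => ->.
have p1 t q p k : extension Ht t (q + vecZ R k) p = extension Ht t q p.
  rewrite /extension; case: ltP => // p1.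
  by apply: (H_periodic (z := (clamp01 t, q, p))); split; [exact: clamp01_in|].
have p2 t q p k : extension (partial_q H) t (q + vecZ R k) p = extension (partial_q H) t q p.
  by rewrite /extension; case: ltP => // p1'; case: (partial_periodic q k (clamp01_in t) p1').
have p3 t q p k : extension (partial_p H) t (q + vecZ R k) p = extension (partial_p H) t q p.
  by rewrite /extension; case: ltP => // p1'; case: (partial_periodic q k (clamp01_in t) p1').
have unif (V : normedModType R) (F : R -> vec -> vec -> V) :
    continuous (fun z : phase => extension F z.1.1 z.1.2 z.2) ->
    (forall t q p k, extension F t (q + vecZ R k) p = extension F t q p) ->
    forall eps, 0 < eps -> exists2 delta, 0 < delta &
    forall t t' q q' p p', `|t - t'| <= delta -> `|q - q'| <= delta -> `|p - p'| <= delta ->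
    `|extension F t q p - extension F t' q' p'| <= eps.
  move=> Fc Fp; apply: (periodic_unif Fc) => *; [exact: ecl|exact: Fp|exact: esupp].
have bnd (V : normedModType R) (F : R -> vec -> vec -> V) :
    continuous (fun z : phase => extension F z.1.1 z.1.2 z.2) ->
    (forall t q p k, extension F t (q + vecZ R k) p = extension F t q p) ->
    exists C, forall t q p, `|extension F t q p| <= C.
  move=> Fc Fp; apply: (periodic_bounded Fc) => *; [exact: ecl|exact: Fp|exact: esupp].
have van t q p : r < enorm p ->
    [/\ extension Ht t q p = 0, extension (partial_q H) t q p = 0 & extension (partial_p H) t q p = 0].
  move=> rp; rewrite /extension; case: ltP => // p1'.
  by rewrite /Ht H0 ?v2 ?v3 ?clamp01_in.
exists r; split => //.
- by rewrite r0.
- have [C1 h1] := bnd _ _ c1 p1; have [C2 h2] := bnd _ _ c2 p2; have [C3 h3] := bnd _ _ c3 p3.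
  exists (Num.max C1 (Num.max C2 C3)) => t q p.
  split; [apply: le_trans (h1 t q p) _|apply: le_trans (h2 t q p) _|apply: le_trans (h3 t q p) _];
    by rewrite !le_max lexx ?orbT.
- move=> eps eps0.
  have [d1 d10 h1] := unif _ _ c1 p1 _ eps0; have [d2 d20 h2] := unif _ _ c2 p2 _ eps0.
  have [d3 d30 h3] := unif _ _ c3 p3 _ eps0.
  exists (Num.min d1 (Num.min d2 d3)); first by rewrite !lt_min d10 d20.
  move=> t t' q q' p p'; rewrite !le_min => /and3P[? ? ?] /and3P[? ? ?] /and3P[? ? ?].
  by split; [exact: h1|exact: h2|exact: h3].
- move=> eps eps0.
  have n0 : 0 < (n%:R + n%:R + 1 : R) by rewrite ltr_pwDr // addr_ge0.
  pose eta := eps / (n%:R + n%:R + 1).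
  have eta0 : 0 < eta by rewrite divr_gt0.
  have etaE : (n%:R + n%:R) * eta <= eps.
    rewrite [leRHS](_ : eps = (n%:R + n%:R + 1) * eta); last by rewrite /eta mulrC divfK // gt_eqF.
    by rewrite ler_wpM2r ?(ltW eta0) // lerDl.
  have [d2 d20 h2] := unif _ _ c2 p2 _ eta0; have [d3 d30 h3] := unif _ _ c3 p3 _ eta0.
  exists (Num.min d2 d3); first by rewrite lt_min d20.
  move=> t q p a b; rewrite !le_min => /andP[a2 a3] /andP[b2 b3].
  have z0 (W : normedModType R) (x : W) (d : R) : 0 < d -> `|x - x| <= d.
    by move=> d0; rewrite subrr normr0 ltW.
  have X1 := @coordinate_expand R n (fun x => extension Ht t x (p + b)) (fun x => extension (partial_q H) t x (p + b))
    (fun x i s => extension_derive_q t x (p + b) i s) eta d2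
    (fun x y xy => h2 t t x y (p + b) (p + b) (z0 _ _ _ d20) xy (z0 _ _ _ d20)) q a a2.
  have X2 := @coordinate_expand R n (fun y => extension Ht t q y) (fun y => extension (partial_p H) t q y)
    (fun x i s => @extension_derive_p r t q x i s r1 H0) eta d3
    (fun x y xy => h3 t t q q x y (z0 _ _ _ d30) (z0 _ _ _ d30) xy) p b b3.
  have X3 : `|dot (extension (partial_q H) t q (p + b) - extension (partial_q H) t q p) a| <= n%:R * (eta * `|a|).
    apply: le_trans (dot_le_norm _ _) _; rewrite ler_wpM2l // ler_wpM2r //.
    by apply: h2; [exact: z0|exact: z0|rewrite addrAC subrr add0r].
  have -> : extension Ht t (q + a) (p + b) - extension Ht t q p - dot (extension (partial_q H) t q p) a
      - dot (extension (partial_p H) t q p) b =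
    (extension Ht t (q + a) (p + b) - extension Ht t q (p + b) - dot (extension (partial_q H) t q (p + b)) a)
    + dot (extension (partial_q H) t q (p + b) - extension (partial_q H) t q p) a
    + (extension Ht t q (p + b) - extension Ht t q p - dot (extension (partial_p H) t q p) b).
    by rewrite dotBl; ring.
  apply: (@le_trans _ _ ((n%:R + n%:R) * eta * (`|a| + `|b|))); last first.
    by rewrite ler_wpM2r // addr_ge0.
  have -> : (n%:R + n%:R) * eta * (`|a| + `|b|) =
    n%:R * (eta * `|a|) + n%:R * (eta * `|a|) + n%:R * (eta * `|b|) + n%:R * (eta * `|b|) by ring.
  apply: (@le_trans _ _ (n%:R * (eta * `|a|) + n%:R * (eta * `|a|) + n%:R * (eta * `|b|))); last first.
    by rewrite lerDl mulr_ge0 // mulr_ge0 // ltW.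
  apply: le_trans (ler_normD _ _) _; apply: lerD => //.
  by apply: le_trans (ler_normD _ _) _; apply: lerD.
Qed.

End TameExtension.

(** * Existence of the periodic orbit *)

Theorem theoremB (R : realType) (n : nat) (H : extended_phase R n -> R)
    (H_periodic : torus_periodic H)
    (H_smooth : smooth_on (@time_phase R n) H)
    (H_supp : compactly_supported H)
    (e : 'rV[int]_n)
    (e_le : enorm (vecZ R e) <= inf (H @` @zero_section R n)) :
  exists q p : R -> 'rV[R]_n,
    [/\ hamiltonian_solution H q p,
        periodic_in_class e q p &
        inf (H @` @zero_section R n) <= action H q p].
Proof.
set c := inf _ in e_le *.
have [r tH] := extension_tame H_periodic H_smooth H_supp.
have /andP[_ r1] := tame_radius tH.
have [C HC] := tame_bounded tH.
have zero1 : enorm (0 : 'rV[R]_n) < 1 by rewrite enorm0.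
have cH t q : 0 <= t <= 1 -> c <= extension (fun t q p => H (t, q, p) : R^o) t q 0.
  move=> t01; rewrite extension_in //; apply: ge_inf; last by exists (t, q, 0).
  exists (- C) => _ [[[t' q'] p'] /= [t'01 /= ->] <-].
  have [h _ _] := HC t' q' 0.
  by move: h; rewrite extension_in // ler_norml => /andP[].
have [q [p [S [pr sol q1 p1 cS]]]] := tame_solution tH cH e_le.
have p_lt1 t : 0 <= t <= 1 -> enorm (p t) < 1 by move=> t01; apply: le_lt_trans (pr t t01) r1.
have {}sol t : 0 <= t <= 1 -> [/\ has_velocity01 q t (partial_p H t (q t) (p t)),
        has_velocity01 p t (- partial_q H t (q t) (p t)) &
        has_velocity01 (S : R -> R^o) t (H (t, q t, p t) - dot (p t) (partial_p H t (q t) (p t)))].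
  move=> t01; have [s1 s2 s3] := sol t t01.
  by move: s1 s2 s3; rewrite /lagrangian !(extension_in _ _ t01 (p_lt1 t t01)).
exists q, p; split.
- move=> t t01; have [s1 s2 _] := sol t t01.
  split; [exact: p_lt1|exact: has_velocity01_quotients|exact: has_velocity01_quotients].
- by [].
apply: (le_trans cS).
pose f t := H (t, q t, p t) - dot (p t) (partial_p H t (q t) (p t)).
have fS t : 0 <= t <= 1 -> has_velocity01 (S : R -> R^o) t (f t) by case/sol.
have fc : {within `[0, 1]%classic, continuous f}.
  apply: within01_continuous => t t01 eps eps0.
  have [d d0 Hd] := lagrangian_unif tH HC eps0.
  have [v1 v2 _] := sol t t01.
  have [d1 d10 H1] := has_velocity01_continuous v1 d0.
  have [d2 d20 H2] := has_velocity01_continuous v2 d0.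
  exists (Num.min d (Num.min d1 d2)); first by rewrite !lt_min d0 d10.
  move=> s s01; rewrite !le_min => /and3P[sd s1 s2].
  have := Hd s t (q s) (q t) (p s) (p t) sd (H1 s s01 s1) (H2 s s01 s2) (pr s s01) (pr t t01).
  by rewrite /lagrangian !(extension_in _ _ s01 (p_lt1 s s01)) !(extension_in _ _ t01 (p_lt1 t t01)).
rewrite -(integral_has_velocity01 fc fS) /action le_eqVlt; apply/orP; left; apply/eqP.
apply: eq_Rintegral => t; rewrite inE /= in_itv /= => t01.
by have [v1 _ _] := sol t t01; rewrite (has_velocity01_velocity t01 v1).
Qed.
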